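(* Let $T>0$ and let $a\in L^{p}[0,T]$, $b\in L^{q}[0,T]$, $c\in L^{r}[0,T]$ with $p\in[2,\infty]$, $q\in(1,\infty]$, $r\in[1,\infty]$ satisfying $1/p+1/q+1/r<\frac32$. Then the stochastic process $$X_t=\int_0^t\left(a(s)\int_s^t b(u)\,c(u-s)\,du\right)dW_s,\qquad t\in[0,T],$$ has a modification that satisfies the Hölder condition up to order $\frac32-1/q-\max\left(\frac12,\ 1/p+1/r\right)$ on $[0,T]$.
   Context: $W$ is a standard Wiener process; the stochastic integral is the Wiener integral of a deterministic function. A process satisfies the Hölder condition up to order $\lambda>0$ on an interval if its trajectories satisfy the $\gamma$-Hölder condition on that interval (with a finite random constant depending on $\gamma$) for every $\gamma\in(0,\lambda)$. Convention: $1/\infty=0$. *)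

(* Defs.v *)
From HB Require Import structures.
From mathcomp Require Import all_boot all_order all_algebra.
From mathcomp Require Import all_classical all_reals all_analysis.

Set Implicit Arguments.
Unset Strict Implicit.
Unset Printing Implicit Defensive.

Import Order.TTheory GRing.Theory Num.Theory.
Import numFieldNormedType.Exports.

Local Open Scope classical_set_scope.
Local Open Scope ring_scope.

Section Wiener.
Context {d : measure_display} {Omega : measurableType d} {R : realType}.
Variable P : probability Omega R.

Local Notation mu := (@lebesgue_measure R).

(* Since [B i = setT] is allowed, the product rule for the full family
   contains the product rule for every subfamily. *)
Definition mutually_independent (n : nat) (X : 'I_n -> Omega -> R) : Prop :=
  forall B : 'I_n -> set (measurableTypeR R), (forall i, measurable (B i)) ->
    P (\bigcap_(i in [set: 'I_n]) (X i @^-1` B i)) =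
    (\prod_(i < n) P (X i @^-1` B i))%E.

(* The time set is [0, +oo[; the values of [W] at negative times are
   irrelevant. *)
Definition independent_increments (W : R -> {RV P >-> R}) : Prop :=
  forall (n : nat) (u : nat -> R), 0 <= u 0%N ->
    (forall i, (i < n)%N -> u i <= u i.+1) ->
    mutually_independent (fun (i : 'I_n) w => W (u i.+1) w - W (u i) w).

(* The second parameter of [normal_prob] is the standard deviation. *)
Definition wiener_process (W : R -> {RV P >-> R}) : Prop :=
  [/\ {ae P, forall w, W 0 w = 0},
      independent_increments W,
      forall s t : R, 0 <= s -> s < t ->
        forall B : set (measurableTypeR R), measurable B ->
          P ((fun w => W t w - W s w) @^-1` B) =
          normal_prob 0 (Num.sqrt (t - s)) B
    & {ae P, forall w, {within `[0, +oo[, continuous (fun t => W t w)}}].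

(* A step function on [0, t] is encoded by a list of triples (z, (u, v))
   standing for the sum of the functions z * 1_(]u, v]); the intervals need
   not be disjoint. *)
Definition step_on (t : R) (h : seq (R * (R * R))) : bool :=
  all (fun k => [&& 0 <= k.2.1, k.2.1 <= k.2.2 & k.2.2 <= t]) h.

Definition step_fun (h : seq (R * (R * R))) (x : R) : R :=
  \sum_(k <- h) k.1 * \1_(`]k.2.1, k.2.2] : set R) x.

Definition step_integral (W : R -> {RV P >-> R}) (h : seq (R * (R * R)))
    (w : Omega) : R :=
  \sum_(k <- h) k.1 * (W k.2.2 w - W k.2.1 w).

(* Membership of a function, given on [0, t], in L^p[0, t]: its extension by
   zero is a measurable function with finite L^p norm. *)
Definition Lp_on (t : R) (p : \bar R) (f : R -> R) : Prop :=
  (f \_ `[0, t] : measurableTypeR R -> R) \in Lfun mu p.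

(* [Y] is a version of the Wiener integral of [f] over [0, t]: the limit in
   L^2(P) of the integrals of step functions converging to [f] in L^2[0, t].
   The integral being defined up to almost sure equality only, it is a
   relation. *)
Definition wiener_integral (W : R -> {RV P >-> R}) (t : R) (f : R -> R)
    (Y : {RV P >-> R}) : Prop :=
  Lp_on t 2%:E f /\
  exists h : nat -> seq (R * (R * R)),
    [/\ forall n, step_on t (h n),
        'N[mu]_(2%:E)[EFin \o ((fun x => f x - step_fun (h n) x) \_ `[0, t])%R]%E
          @[n --> \oo] --> 0%E
      & 'N[P]_(2%:E)[EFin \o (fun w => Y w - step_integral W (h n) w)%R]%E
          @[n --> \oo] --> 0%E].

Definition modification_on (A : set R) (X Y : R -> {RV P >-> R}) : Prop :=
  forall t, A t -> {ae P, forall w, Y t w = X t w}.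

Definition volterra_kernel (a b c : R -> R) (t s : R) : R :=
  a s * \int[mu]_(u in `[s, t]) (b u * c (u - s)).

End Wiener.

Definition holder_on {R : realType} (A : set R) (g : R) (f : R -> R) : Prop :=
  exists C : R, forall s t, A s -> A t -> `|f t - f s| <= C * `|t - s| `^ g.

Definition holder_up_to {R : realType} (A : set R) (lambda : \bar R)
    (f : R -> R) : Prop :=
  forall g : R, 0 < g -> (g%:E < lambda)%E -> holder_on A g f.

(* Main.v *)
(* Choose finite exponents A >= 1/p, C >= 1/r and Q >= 1/q with A <= 1/2 and
   A + C >= 1/2, put B := 3/2 - A - C, and arrange B - Q = H for a prescribed
   H below the critical exponent. For s <= t the increment K_t - K_s of the
   kernel is bounded by |a| times the convolution of |b| 1_[s,t] with |c|. With
   F = |a|^(1/A), G = (|b|^(1/Q) + 1/(t-s)) 1_[s,t] and L = (|c|^(1/C) + 1)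
   1_[0,T], a pointwise Young inequality gives
   (K_t - K_s)^2 <= const (t-s)^(2H) (F + G * L + 1), and by Tonelli the last
   factor has an integral bounded uniformly in s and t.
   Integrals of step functions are Gaussian, so P(|X_t - X_s| >= z) decays
   exponentially in z / (t-s)^H, first for step functions and then for their
   L^2 limits. By Borel-Cantelli the increments of X over neighbouring dyadic
   points of level n are almost surely O(2^(-ng)) for every g < H, and the
   modification is the limit of X along the dyadic points just below t. *)

(* The term 1/2 in the maximum originates in the Young inequality: its exponent [1 - B] must be
   nonnegative, that is [A + C >= 1/2], so [A + C] cannot fall below [max(1/2, 1/p + 1/r)]. The
   summand [1/(t-s)] of [G] has integral one over [[s, t]] whatever its length, and [(t-s) G >= 1]
   there: powers of [G] can be traded for powers of [t - s] at no cost in the integral, which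
   produces the Hölder exponent. Infinite [p], [q], [r] need no separate treatment, since only
   finite powers integrable over [[0, T]] enter, and the inequality is pointwise so that Tonelli
   alone integrates it.

   A single moment of order k in Kolmogorov's criterion would cost 1/k in the exponent. An
   exponential moment beats every power of the number [2^n] of dyadic increments at once; it comes
   from the independent increments of [W], and the law of the [L^2] limit never has to be
   identified. Each [X t] is fixed only up to a null set, so the path estimates may involve
   countably many times only. *)
Require Import Defs.
From HB Require Import structures.
From mathcomp Require Import all_boot all_order all_algebra.
From mathcomp Require Import all_classical all_reals all_analysis.
From mathcomp Require Import measurable_realfun ess_sup_inf zify ring lra.

Set Implicit Arguments.
Unset Strict Implicit.
Unset Printing Implicit Defensive.

Import Order.TTheory GRing.Theory Num.Theory.
Import numFieldNormedType.Exports.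

Local Open Scope classical_set_scope.
Local Open Scope ring_scope.

(** * Integration *)

Section integral_tools.
Local Open Scope ereal_scope.
Import HBNNSimple.

(* Applied with [g1 = 1] to integrate against a law given by a density, and with
   [X1 = X2] to factor an expectation from the product rule for events. *)
Lemma ge0_integral_transfer d1 d2 d' (T1 : measurableType d1)
    (T2 : measurableType d2) (S : measurableType d') (R : realType)
    (m1 : {measure set T1 -> \bar R}) (m2 : {measure set T2 -> \bar R})
    (X1 : T1 -> S) (X2 : T2 -> S) (g1 : T1 -> R) (g2 : T2 -> R)
    (phi : S -> \bar R) :
  measurable_fun setT X1 -> measurable_fun setT X2 ->
  measurable_fun setT g1 -> measurable_fun setT g2 ->
  (forall x, (0 <= g1 x)%R) -> (forall x, (0 <= g2 x)%R) ->
  measurable_fun setT phi -> (forall y, 0 <= phi y) ->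
  (forall B, measurable B ->
    \int[m1]_x ((g1 x)%:E * (\1_B (X1 x))%:E) =
    \int[m2]_x ((g2 x)%:E * (\1_B (X2 x))%:E)) ->
  \int[m1]_x ((g1 x)%:E * phi (X1 x)) = \int[m2]_x ((g2 x)%:E * phi (X2 x)).
Proof.
move=> mX1 mX2 mg1 mg2 g10 g20 mphi phi0 H.
pose a := nnsfun_approx measurableT mphi.
(* Simple approximations of [phi] bring both sides to one form, in which the measure, the map and
   the weight occur only through indicators of level sets; the hypothesis then applies term by
   term. *)
have sums d0 (T : measurableType d0) (m : {measure set T -> \bar R})
   (X : T -> S) (g : T -> R) : measurable_fun setT X ->
   measurable_fun setT g -> (forall x, (0 <= g x)%R) ->
   \int[m]_x ((g x)%:E * phi (X x)) =
   limn (fun n => \sum_(y \in range (a n))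
     (y%:E * \int[m]_x ((g x)%:E * (\1_(a n @^-1` [set y]) (X x))%:E))).
  move=> mX mg g0.
  have mg' : measurable_fun setT (fun x => (g x)%:E) by exact/measurable_EFinP.
  have mind n y : measurable_fun setT
      (fun x : T => (\1_(a n @^-1` [set y]) (X x))%:E : \bar R).
    apply/measurable_EFinP; apply: measurableT_comp => //.
  have ma n : measurable_fun setT (fun x : T => (a n (X x))%:E : \bar R).
    by apply/measurable_EFinP; apply: measurableT_comp => //.
  transitivity (\int[m]_x limn (fun n => (g x)%:E * (a n (X x))%:E)).
    apply: eq_integral => x _; apply/esym/cvg_lim => //.
    by apply: cvgeZl => //; exact: cvg_nnsfun_approx.
  rewrite monotone_convergence//; last 3 first.
  - by move=> n; exact: emeasurable_funM.
  - by move=> n x _; rewrite mule_ge0// lee_fin.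
  - move=> x _ n1 n2 n12; rewrite lee_pmul// ?lee_fin//.
    by have /lefP := nd_nnsfun_approx measurableT mphi n12; exact.
  congr (limn _); apply/funext => n.
  under eq_integral => x _.
    rewrite fimfunE -fsumEFin// ge0_mule_fsumr; last first.
      by move=> y; rewrite nnfun_muleindic_ge0.
    under eq_fsbigr do rewrite EFinM muleCA.
    over.
  rewrite ge0_integral_fsum//.
  - apply: eq_fsbigr => y /[!inE] -[s _ <-].
    rewrite ge0_integralZl//.
    + exact: emeasurable_funM mg' (mind _ _).
    + by move=> x _; rewrite mule_ge0// lee_fin.
    + by rewrite lee_fin.
  - by move=> y; apply: emeasurable_funM => //; exact:
    emeasurable_funM mg' (mind _ _).
  - move=> y x _; rewrite muleCA mule_ge0//; first by rewrite lee_fin.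
    by rewrite nnfun_muleindic_ge0.
rewrite !sums//; congr (limn _); apply/funext => n.
by apply: eq_fsbigr => y _; rewrite H.
Qed.

Lemma measurable_norm_ge d (T : measurableType d) (R : realType) (f : T -> R)
    (z : R) :
  measurable_fun setT f -> measurable [set x | (z <= `|f x|)%R].
Proof.
move=> mf; rewrite -[X in measurable X]setTI.
have mnf : measurable_fun setT (fun x => `|f x|%R) by exact: measurableT_comp.
have := mnf measurableT `[z, +oo[%classic; rewrite preimage_itvcy; apply.
exact: measurable_itv.
Qed.

Lemma integral_mul_indic d (T : measurableType d) (R : realType)
    (m : {measure set T -> \bar R}) (f : T -> R) (E : set T) :
  measurable E ->
  \int[m]_x (f x * \1_E x)%:E = \int[m]_(x in E) (f x)%:E.
Proof.
move=> mE; rewrite [RHS]integral_mkcond; apply: eq_integral => x _.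
by rewrite patchE indicE; case: ifP => _; rewrite ?mulr1 ?mulr0.
Qed.

(** The image of Lebesgue measure under the reflection gives every interval its length, so it is
    Lebesgue measure by uniqueness; half-open intervals come out closed at the other end, which does
    not change their length. *)
Lemma lebesgue_integral_reflect (R : realType) (f : R -> \bar R) (u : R) :
  measurable_fun setT f -> (forall y, 0 <= f y) ->
  \int[lebesgue_measure]_x f (u - x)%R = \int[lebesgue_measure]_x f x.
Proof.
move=> mf f0.
pose t : R -> measurableTypeR R := fun x => (u - x)%R.
have mt : measurable_fun [set: measurableTypeR R] t by exact: measurable_funB.
have f0' : {in [set: measurableTypeR R], forall y, 0 <= f y} by move=> y _.
have := ge0_integral_pushforward mt lebesgue_measure measurableT mf f0'.
rewrite preimage_setT => /esym ->.
apply: eq_measure_integral => A mA _; apply/esym/lebesgue_measure_unique => //.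
move=> _ [[a b]] _ <-; rewrite /pushforward/=.
transitivity (lebesgue_measure (`[(u - b)%R, (u - a)%R[%classic : set R)).
  rewrite !lebesgue_measure_itv/= !lte_fin ltrD2l ltrN2.
  by case: ifP => // _; rewrite -!EFinB; congr EFin; ring.
congr (lebesgue_measure _); apply/seteqP; split => x/=; rewrite /t !in_itv/=;
  lra.
Qed.

End integral_tools.

(** * The Volterra kernel *)

Section young_pointwise.
Context {R : realType}.
Implicit Types (a b c f g : R -> R).
Local Notation mu := (@lebesgue_measure R).

(** Each base is at most the sum of the three and the weights add up to 1. This crude form of
    Young's inequality has constant 1 and admits zero weights. *)
Lemma powR_prod3_le (x y z u v w : R) : 0 <= x -> 0 <= y -> 0 <= z ->
  0 < x + y + z -> 0 <= u -> 0 <= v -> 0 <= w -> u + v + w = 1 ->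
  x `^ u * y `^ v * z `^ w <= x + y + z.
Proof.
move=> x0 y0 z0 S0 u0 v0 w0 uvw.
have -> : x + y + z = (x + y + z) `^ u * (x + y + z) `^ v * (x + y + z) `^ w.
  have S1 : x + y + z != 0 by rewrite gt_eqF.
  by rewrite -!powRD ?uvw ?powRr1 ?S1 ?implybT// ltW.
by rewrite !ler_pM ?mulr_ge0 ?powR_ge0// ge0_ler_powR ?nnegrE//; lra.
Qed.

(* For the two factors [G] and [L] in the parentheses, the left-hand side is at
   most [dl^(B-Q) G^B L^C = dl^(B-Q) (G L)^(1/2-A) G^(1-C) L^(1-B)], where the
   last three exponents sum to 1. *)
Lemma powR_young_pointwise (A B C Q dl N b c : R) : 0 < A -> A <= 2^-1 ->
  0 < C -> C <= 1 -> B = 3 / 2 - A - C -> B <= 1 -> 0 < Q -> Q <= B ->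
  0 < dl -> 0 < N -> 0 <= b -> 0 <= c ->
  b * c <= dl `^ (B - Q) * N `^ (2^-1 - A) *
    ((b `^ Q^-1 + dl^-1) * (c `^ C^-1 + 1) / N + (b `^ Q^-1 + dl^-1)
     + (c `^ C^-1 + 1)).
Proof.
move=> A0 A2 C0 C1 BE B1 Q0 QB dl0 N0 b0 c0.
set G : R := _ + dl^-1; set H : R := _ + 1.
have idl0 : 0 < dl^-1 by rewrite invr_gt0.
have bQ0 : 0 <= b `^ Q^-1 by exact: powR_ge0.
have cC0 : 0 <= c `^ C^-1 by exact: powR_ge0.
have G0 : 0 < G by rewrite /G; lra.
have H0 : 0 < H by rewrite /H; lra.
(* The summand [dl^-1] gives [dl * G >= 1], so [b <= G^Q <= G^Q (dl G)^(B-Q)]. *)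
have bG : b <= dl `^ (B - Q) * G `^ B.
  have -> : G `^ B = G `^ Q * G `^ (B - Q).
    by rewrite -powRD ?(gt_eqF G0) ?implybT//; congr (_ `^ _); lra.
  rewrite mulrCA -powRM ?(ltW G0) ?(ltW dl0)//.
  have -> : b = b `^ Q^-1 `^ Q * 1.
    by rewrite mulr1 -powRrM mulVf ?gt_eqF// powRr1.
  rewrite ler_pM ?powR_ge0//.
    by apply: ge0_ler_powR; rewrite ?nnegrE ?(ltW G0) ?(ltW Q0)// /G; lra.
  have h1 : 1 <= dl * G by rewrite mulrDr divff ?gt_eqF// lerDr mulr_ge0//
    (ltW dl0).
  apply: (@le_trans _ _ (1 `^ (B - Q))); first by rewrite powR1.
  by apply: ge0_ler_powR; rewrite ?nnegrE; lra.
have cH : c <= H `^ C.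
  have -> : c = c `^ C^-1 `^ C by rewrite -powRrM mulVf ?gt_eqF// powRr1.
  by apply: ge0_ler_powR; rewrite ?nnegrE ?(ltW H0) ?(ltW C0)// /H; lra.
apply: (le_trans (ler_pM b0 c0 bG cH)).
rewrite -(mulrA _ (G `^ B)) -(mulrA _ (N `^ _)) ler_wpM2l ?powR_ge0//.
(* The product [G H] is normalised by [N] before the three-term inequality is applied: once [N]
   exceeds the convolution of the two factors, [G H / N] integrates to at most 1. *)
have -> : G `^ B * H `^ C = N `^ (2^-1 - A) *
    ((G * H / N) `^ (2^-1 - A) * G `^ (1 - C) * H `^ (1 - B)).
  have -> : N `^ (2^-1 - A) * ((G * H / N) `^ (2^-1 - A) * G `^ (1 - C) *
    H `^ (1 - B)) =
    (N * (G * H / N)) `^ (2^-1 - A) * G `^ (1 - C) * H `^ (1 - B).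
    rewrite [in RHS]powRM ?mulrA//; first exact: ltW.
    by rewrite divr_ge0 ?mulr_ge0 ?ltW.
  rewrite (mulrC N) divfK ?gt_eqF// powRM ?(ltW G0) ?(ltW H0)//.
  have -> : B = (2^-1 - A) + (1 - C) by lra.
  have -> : H `^ C = H `^ ((2^-1 - A) + (1 - (2^-1 - A + (1 - C)))).
    by congr (_ `^ _); lra.
  rewrite !powRD ?(gt_eqF G0) ?(gt_eqF H0) ?implybT//; ring.
have GHN0 : 0 < G * H / N by rewrite divr_gt0// mulr_gt0.
by rewrite ler_wpM2l ?powR_ge0// powR_prod3_le//; lra.
Qed.
End young_pointwise.

Section convolution.
Context {R : realType}.
Implicit Types (a b c f g : R -> R).
Local Notation mu := (@lebesgue_measure R).

Lemma measurable_conv_integrand f g : measurable_fun [set: R] f ->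
  measurable_fun [set: R] g ->
  measurable_fun [set: measurableTypeR R * measurableTypeR R]
    (fun z => (f z.2 * g (z.2 - z.1))%:E).
Proof.
move=> mf mg; apply/measurable_EFinP; apply: measurable_funM.
  by apply: measurableT_comp mf _.
by apply: (measurableT_comp mg); apply: measurable_funB.
Qed.

Lemma integral_conv f g : measurable_fun setT f -> measurable_fun setT g ->
  (forall x, 0 <= f x) -> (forall x, 0 <= g x) ->
  (\int[mu]_x \int[mu]_u (f u * g (u - x))%:E =
   \int[mu]_x (f x)%:E * \int[mu]_x (g x)%:E)%E.
Proof.
move=> mf mg f0 g0.
have := fubini_tonelli (m1 := mu) (m2 := mu)
  (fun z => (f z.2 * g (z.2 - z.1))%:E)
  (measurable_conv_integrand mf mg).
move=> /= ->; last by move=> z; rewrite lee_fin mulr_ge0.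
under eq_integral => u _.
  under eq_integral do rewrite EFinM.
  rewrite ge0_integralZl//=; last 3 first.
  - by apply/measurable_EFinP; apply: (measurableT_comp mg); apply:
    measurable_funB.
  - by move=> x _; rewrite lee_fin.
  - by rewrite lee_fin.
  rewrite (lebesgue_integral_reflect (f := EFin \o g)); last 2 first.
  - exact/measurable_EFinP.
  - by move=> y; rewrite lee_fin.
  over.
rewrite ge0_integralZr//=; first exact/measurable_EFinP.
- by move=> x _; rewrite lee_fin.
- by apply: integral_ge0 => x _; rewrite lee_fin.
Qed.

Lemma measurable_conv f g : measurable_fun setT f -> measurable_fun setT g ->
  (forall x, 0 <= f x) -> (forall x, 0 <= g x) ->
  measurable_fun setT (fun x : measurableTypeR R => \int[mu]_u
    (f u * g (u - x))%:E)%E.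
Proof.
move=> mf mg f0 g0.
have := @measurable_fun_fubini_tonelli_F _ _ (measurableTypeR R)
  (measurableTypeR R) R mu _ (measurable_conv_integrand mf mg).
by apply => z; rewrite lee_fin mulr_ge0.
Qed.
End convolution.

(** * Uniform [L^2] bound for the kernel over a short interval *)

Section kernel_L2_bound.
Context {R : realType}.
Implicit Types (a b c f g : R -> R).
Local Notation mu := (@lebesgue_measure R).

(** Absorbs the power of [N] that remains after squaring the pointwise bound: [a^2] is the power
    [2 A] of [a^(1/A)], and the weights [2 A] and [1 - 2 A] add up to 1. The third slot of the
    three-term inequality is left empty. *)
Lemma powR_young2_pointwise (A a N : R) : 0 < A -> A <= 2^-1 -> 0 < N ->
  0 <= a -> a ^+ 2 * N `^ (1 - 2 * A) <= a `^ A^-1 + N.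
Proof.
move=> A0 A2 N0 a0.
have := @powR_prod3_le R (a `^ A^-1) N 0 (2 * A) (1 - 2 * A) 0.
rewrite powRr0 mulr1 addr0 -powRrM mulrCA mulVf ?gt_eqF// mulr1.
rewrite powR_mulrn//; apply; rewrite ?powR_ge0//; try lra.
by have := powR_ge0 a A^-1; lra.
Qed.

Definition abs_kernel b c (T s t x : R) : \bar R :=
  (\int[mu]_u (`|b u| * \1_(`[s, t] : set R) u *
      (`|c (u - x)| * \1_(`[0%R, T] : set R) (u - x)))%:E)%E.

Lemma kernel_L2_bound (A B C Q T : R) a b c (ma mb mc : R) :
  0 < A -> A <= 2^-1 -> 0 < C -> C <= 1 -> B = 3 / 2 - A - C -> B <= 1 ->
  0 < Q -> Q <= B -> 0 < T ->
  measurable_fun setT a -> measurable_fun setT b -> measurable_fun setT c ->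
  (\int[mu]_(x in `[0%R, T]) (`|a x| `^ A^-1)%:E <= ma%:E)%E ->
  (\int[mu]_(x in `[0%R, T]) (`|b x| `^ Q^-1)%:E <= mb%:E)%E ->
  (\int[mu]_(x in `[0%R, T]) (`|c x| `^ C^-1)%:E <= mc%:E)%E ->
  exists2 K : R, 0 <= K & forall s t dl, 0 <= s -> s <= t -> t <= T ->
    0 < dl -> t - s <= dl ->
    (\int[mu]_(x in `[0%R, T]) ((a x ^+ 2)%:E *
      (abs_kernel b c T s t x * abs_kernel b c T s t x)) <=
    (K * dl `^ (2 * (B - Q)))%:E)%E.
Proof.
move=> A0 A2 C0 C1 BE B1 Q0 QB T0 ma_ mb_ mc_ Ia Ib Ic.
have pow_ge0 f p : (0 <= \int[mu]_(x in `[0%R, T]) (`|f x| `^ p)%:E)%E.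
  by apply: integral_ge0 => x _; rewrite lee_fin powR_ge0.
have ma0 : 0 <= ma by rewrite -lee_fin (le_trans _ Ia).
have mb0 : 0 <= mb by rewrite -lee_fin (le_trans _ Ib).
have mc0 : 0 <= mc by rewrite -lee_fin (le_trans _ Ic).
have mpow f p : measurable_fun setT f ->
    measurable_fun setT (fun x => `|f x| `^ p).
  move=> mf; apply: (measurableT_comp (measurable_powR _)).
  exact: measurableT_comp.
have leb0T : mu (`[0%R, T] : set R) = T%:E.
  by rewrite lebesgue_measure_itv/= lte_fin T0 sube0.
(* The three summands bound the integrals of [G H / N], [G] and [H]. The 1 in [mb + 1] bounds
   [(t - s) / dl], and the [T] in [mc + T] is the integral of 1 over [[0, T]]. *)
pose k := 1 + (mb + 1) + (mc + T).
have k0 : 0 < k by rewrite /k; lra.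
(* The second factor bounds the integral over [[0, T]] of [|a|^(1/A) + N + 1], where the convolution
   [N] integrates to the product of the integrals of [G] and [H]. *)
exists (k ^+ 2 * (ma + (mb + 1) * (mc + T) + T)).
  by rewrite mulr_ge0 ?sqr_ge0// !addr_ge0 ?mulr_ge0 ?addr_ge0// ltW.
move=> s t dl s0 st tT dl0 tsdl; pose D := abs_kernel b c T s t; rewrite -/D.
have idl0 : 0 < dl^-1 by rewrite invr_gt0.
pose G u := (`|b u| `^ Q^-1 + dl^-1) * \1_(`[s, t] : set R) u.
pose H w := (`|c w| `^ C^-1 + 1) * \1_(`[0%R, T] : set R) w.
have mG : measurable_fun setT G.
  by apply: measurable_funM => //; apply: measurable_funD => //; exact: mpow.
have mH : measurable_fun setT H.
  by apply: measurable_funM => //; apply: measurable_funD => //; exact: mpow.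
have G0 u : 0 <= G u by rewrite mulr_ge0// addr_ge0 ?powR_ge0// ltW.
have H0 u : 0 <= H u by rewrite mulr_ge0// addr_ge0 ?powR_ge0.
have sub : `[s, t] `<=` (`[0%R, T] : set R).
  by move=> x /=; rewrite !in_itv/=; lra.
have IG : (\int[mu]_x (G x)%:E <= (mb + 1)%:E)%E.
  rewrite integral_mul_indic// EFinD.
  under eq_integral do rewrite EFinD.
  rewrite ge0_integralD//=; last 2 first.
  - by apply/measurable_EFinP; apply: measurable_funTS; exact: mpow.
  - by move=> x _; rewrite lee_fin ltW.
  apply: leeD.
    apply: le_trans Ib; apply: ge0_subset_integral => //.
    - by apply/measurable_EFinP; apply: measurable_funTS; exact: mpow.
  rewrite integral_cst//= lebesgue_measure_itv/= lte_fin.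
  case: ifP => _; last by rewrite mule0.
  by rewrite -EFinB -EFinM lee_fin mulrC ler_pdivrMr// mul1r.
have IH : (\int[mu]_x (H x)%:E <= (mc + T)%:E)%E.
  rewrite integral_mul_indic// EFinD.
  under eq_integral do rewrite EFinD.
  rewrite ge0_integralD//=; last first.
    by apply/measurable_EFinP; apply: measurable_funTS; exact: mpow.
  by apply: leeD => //; rewrite integral_cst//= leb0T mul1e.
pose N x := (\int[mu]_u (G u * H (u - x))%:E)%E.
have N0 x : (0 <= N x)%E.
  by apply: integral_ge0 => u _; rewrite lee_fin mulr_ge0.
have mN : measurable_fun setT N by exact: measurable_conv.
pose b1 u := `|b u| * \1_(`[s, t] : set R) u.
pose c1 u := `|c u| * \1_(`[0, T] : set R) u.
have mb1 : measurable_fun setT b1.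
  by apply: measurable_funM => //; exact: measurableT_comp.
have mc1 : measurable_fun setT c1.
  by apply: measurable_funM => //; exact: measurableT_comp.
have b10 u : 0 <= b1 u by exact: mulr_ge0.
have c10 u : 0 <= c1 u by exact: mulr_ge0.
have mD : measurable_fun setT D by exact: (measurable_conv mb1 mc1).
have D0 x : (0 <= D x)%E.
  by apply: integral_ge0 => u _; rewrite lee_fin (mulr_ge0 (b10 u) (c10 _)).
have mFa : measurable_fun setT (fun x => (`|a x| `^ A^-1)%:E).
  by apply/measurable_EFinP; exact: mpow.
have pt x : ((a x ^+ 2)%:E * (D x * D x) <=
    (k ^+ 2 * dl `^ (2 * (B - Q)))%:E * ((`|a x| `^ A^-1)%:E + N x + 1))%E.
  have kd0 : 0 < k ^+ 2 * dl `^ (2 * (B - Q)).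
    by rewrite mulr_gt0 ?powR_gt0// exprn_gt0.
  (* Where the convolution is infinite the right-hand side is infinite as well. *)
  have := N0 x; case Nx : (N x) => [n||] // ; last first.
    by move=> _; rewrite addey// addye// gt0_muley ?lte_fin// leey.
  rewrite lee_fin => n0.
  (* The normalising constant is [n + 1]: it dominates the convolution at [x] and, unlike [n], is
     always positive. *)
  pose cs := dl `^ (B - Q) * (n + 1) `^ (2^-1 - A).
  have n1 : 0 < n + 1 by lra.
  have cs0 : 0 < cs by rewrite mulr_gt0// powR_gt0.
  have Dk : (D x <= (cs * k)%:E)%E.
    have mHx : measurable_fun setT (fun u : R => (H (u - x))%:E).
      apply/measurable_EFinP; apply: (measurableT_comp mH).
      exact: measurable_funB.
    have mGH : measurable_fun setT (fun u : R => (G u * H (u - x))%:E).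
      apply/measurable_EFinP; apply: measurable_funM => //.
      exact/measurable_EFinP.
    have mG' : measurable_fun setT (fun u : R => (G u)%:E) by
      exact/measurable_EFinP.
    have IHx : (\int[mu]_u (H (u - x))%:E = \int[mu]_u (H u)%:E)%E.
      have mHN : measurable_fun setT (fun v : R => (H (- v))%:E).
        by apply/measurable_EFinP; apply: (measurableT_comp mH).
      have := @lebesgue_integral_reflect R (fun v => (H (- v))%:E) x mHN.
      under eq_integral do rewrite opprB.
      move=> ->; last by move=> y; rewrite lee_fin.
      have := @lebesgue_integral_reflect R (fun v => (H v)%:E) 0.
      under eq_integral do rewrite sub0r.
      by apply => //; exact/measurable_EFinP.
    pose n' := (n + 1)^-1.
    have n'0 : 0 <= n' by rewrite invr_ge0 ltW.
    have Hx0 (u : R) : True -> (0 <= (H (u - x))%:E)%E by rewrite lee_fin.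
    have Gx0 (u : R) : True -> (0 <= (G u)%:E)%E by rewrite lee_fin.
    have GHx0 (u : R) : True -> (0 <= (G u * H (u - x))%:E)%E.
      by rewrite lee_fin mulr_ge0.
    have nGHx0 (u : R) : True -> (0 <= n'%:E * (G u * H (u - x))%:E)%E.
      by move=> _; rewrite mule_ge0 ?lee_fin// mulr_ge0.
    have sGHx0 (u : R) : True -> (0 <= n'%:E * (G u * H (u - x))%:E +
      (G u)%:E)%E.
      by move=> _; rewrite adde_ge0 ?nGHx0 ?Gx0.
    have mnGH : measurable_fun setT (fun u :
      R => (n'%:E * (G u * H (u - x))%:E)%E).
      exact: measurable_funeM.
    have msGH : measurable_fun setT (fun u :
      R => (n'%:E * (G u * H (u - x))%:E + (G u)%:E)%E).
      exact: emeasurable_funD.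
    pose tot (u : R) := (n'%:E * (G u * H (u - x))%:E + (G u)%:E +
      (H (u - x))%:E)%E.
    have mtot : measurable_fun setT tot by exact: emeasurable_funD.
    have tot0 (u : R) : True -> (0 <= tot u)%E.
      by move=> _; rewrite adde_ge0 ?sGHx0 ?Hx0.
    have H1 : (\int[mu]_u (cs%:E * tot u) <= (cs * k)%:E)%E.
      rewrite ge0_integralZl//; last by rewrite lee_fin ltW.
      rewrite (EFinM cs k); apply: lee_wpmul2l; first by rewrite lee_fin ltW.
      rewrite ge0_integralD// ge0_integralD// ge0_integralZl// -/(N x) Nx IHx.
      rewrite /k !EFinD; apply: leeD => //; apply: leeD => //.
      by rewrite -EFinM lee_fin mulrC ler_pdivrMr//; lra.
    apply: le_trans H1; apply: ge0_le_integral => //.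
    - apply/measurable_EFinP; apply: measurable_funM => //.
      by apply: (measurableT_comp mc1); exact: measurable_funB.
    - exact: measurable_funeM.
    - move=> u _; rewrite [leRHS](_ : _ = (cs * (n' * (G u * H (u - x)) + G u +
        H (u - x)))%:E)// lee_fin /G /H !indicE.
      case: (u \in _); last first.
        by rewrite !mulr0 !mul0r mulr0 addr0 add0r mulr_ge0 ?(ltW cs0)//.
      case: (u - x \in _); last first.
        rewrite !(mulr0, mulr1, addr0, add0r) mulr_ge0 ?(ltW cs0)//.
        by rewrite addr_ge0 ?powR_ge0// ltW.
      rewrite !mulr1 mulrC.
      have := powR_young_pointwise A0 A2 C0 C1 BE B1 Q0 QB dl0 n1
        (normr_ge0 (b u)) (normr_ge0 (c (u - x))).
      by rewrite mulrC => /le_trans; apply;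
        rewrite /cs /n' (mulrC _ (n + 1)^-1).
  have [dd dd0 Dd] : exists2 dd, 0 <= dd & D x = dd%:E.
    move: Dk (D0 x); case: (D x) => [dd _||//]; first by rewrite lee_fin;
      exists dd.
    by rewrite leye_eq.
  rewrite Dd lee_fin in Dk; rewrite Dd.
  rewrite [leRHS](_ : _ = (k ^+ 2 * dl `^ (2 * (B - Q)) *
    (`|a x| `^ A^-1 + n + 1))%:E)// [leLHS](_ : _ =
      (a x ^+ 2 * (dd * dd))%:E)//.
  rewrite lee_fin.
  have cs2 : cs ^+ 2 = dl `^ (2 * (B - Q)) * (n + 1) `^ (1 - 2 * A).
    rewrite /cs exprMn -!powR_mulrn ?powR_ge0// -!powRrM.
    by congr (_ `^ _ * _ `^ _); lra.
  have := powR_young2_pointwise A0 A2 n1 (normr_ge0 (a x)).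
  rewrite real_normK ?num_real// => young2.
  apply: (@le_trans _ _ (a x ^+ 2 * (cs * k) ^+ 2)).
    by rewrite ler_wpM2l ?sqr_ge0// -expr2 ler_pXn2r// nnegrE mulr_ge0 ?ltW.
  rewrite exprMn cs2 [leLHS](_ : _ = k ^+ 2 * dl `^ (2 * (B - Q)) *
    (a x ^+ 2 * (n + 1) `^ (1 - 2 * A))); last by ring.
  by rewrite -addrA ler_wpM2l// ltW.
pose kd := k ^+ 2 * dl `^ (2 * (B - Q)).
have kd0 : 0 <= kd by rewrite mulr_ge0 ?powR_ge0 ?sqr_ge0.
have Fa0 (x : R) : `[0%R, T]%classic x -> (0 <= (`|a x| `^ A^-1)%:E)%E.
  by rewrite lee_fin powR_ge0.
have mFaT : measurable_fun `[0, T] (fun x : R => (`|a x| `^ A^-1)%:E).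
  exact: measurable_funTS.
have mNT : measurable_fun `[0, T] N by exact: measurable_funTS.
have N0' (x : R) : `[0%R, T]%classic x -> (0 <= N x)%E by [].
have mFN : measurable_fun `[0, T] (fun x : R => (`|a x| `^ A^-1)%:E + N x)%E.
  exact: emeasurable_funD.
have FN0 (x : R) : `[0%R, T]%classic x -> (0 <= (`|a x| `^ A^-1)%:E + N x)%E.
  by move=> Tx; rewrite adde_ge0 ?Fa0.
apply: (@le_trans _ _ (\int[mu]_(x in `[0%R, T])
  (kd%:E * ((`|a x| `^ A^-1)%:E + N x + 1)))%E).
  apply: ge0_le_integral => //.
  - move=> x _; rewrite mule_ge0 ?lee_fin ?sqr_ge0// mule_ge0//.
  - apply: emeasurable_funM.
      by apply/measurable_EFinP; apply: measurable_funTS; apply: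
        measurable_funX.
    by apply: measurable_funTS; exact: emeasurable_funM.
  - by apply: measurable_funeM; exact: emeasurable_funD.
rewrite ge0_integralZl//; last 2 first.
- exact: emeasurable_funD.
- by move=> x Tx; rewrite adde_ge0 ?FN0.
rewrite ge0_integralD// ge0_integralD// integral_cst//= leb0T mul1e.
rewrite (_ : k ^+ 2 * _ * _ = kd * (ma + (mb + 1) * (mc + T) + T)); last first.
  by rewrite /kd; ring.
rewrite (EFinM kd); apply: lee_wpmul2l; first by rewrite lee_fin.
rewrite EFinD; apply: leeD => //; rewrite EFinD; apply: leeD => //.
apply: (@le_trans _ _ (\int[mu]_x N x)%E).
  exact: ge0_subset_integral.
rewrite integral_conv// EFinM lee_pmul//.
- by apply: integral_ge0 => x _; rewrite lee_fin.
- by apply: integral_ge0 => x _; rewrite lee_fin.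
Qed.
End kernel_L2_bound.

(** * From membership in [L^p] to integrable finite powers *)

Section Lp_on_powers.
Context {R : realType}.
Implicit Types (a b c f g : R -> R).
Local Notation mu := (@lebesgue_measure R).

Lemma Lp_on_measurable (T : R) p f : Lp_on T p f ->
  measurable_fun setT (f \_ `[0, T]).
Proof. by rewrite /Lp_on inE => /andP[/[!inE]]. Qed.

(** The interval has finite measure, so lowering the exponent is free: [|f|^(1/A) <= |f|^p + 1] for
    finite [p], while for infinite [p] the function is essentially bounded. *)
Lemma Lp_on_integral_powR (T : R) p f A : (1 <= p)%E -> 0 < A ->
  (p^-1 <= A%:E)%E -> Lp_on T p f ->
  exists m : R, (\int[mu]_(x in `[0%R, T]) (`|(f \_ `[0, T]) x| `^ A^-1)%:E <=
    m%:E)%E.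
Proof.
move=> p1 A0 pA Lf; have mf := Lp_on_measurable Lf.
set ft := f \_ `[0, T] in mf *.
have mpow q : measurable_fun setT (fun x => `|ft x| `^ q).
  apply: (measurableT_comp (measurable_powR _)).
  exact: measurableT_comp.
have muT : (mu (`[0%R, T] : set R) < +oo)%E.
  by rewrite lebesgue_measure_itv/=; case: ifP => // _; rewrite -EFinB ltry.
suff h : (\int[mu]_(x in `[0%R, T]) (`|ft x| `^ A^-1)%:E < +oo)%E.
  exists (fine (\int[mu]_(x in `[0%R, T]) (`|ft x| `^ A^-1)%:E)).
  rewrite fineK// ge0_fin_numE//; apply: integral_ge0 => x _.
  by rewrite lee_fin powR_ge0.
case: p p1 pA Lf => [q||] //.
- rewrite lee_fin => q1; have q0 : 0 < q by lra.
  rewrite inver gt_eqF// lee_fin => qA /(Lfun_integrable q1) /integrableP[_ I].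
  have Aq : A^-1 <= q by rewrite -[leRHS]invrK lef_pV2// posrE invr_gt0.
  apply: (@le_lt_trans _ _ (\int[mu]_(x in `[0%R, T])
    ((`|ft x| `^ q)%:E + 1))%E).
    apply: ge0_le_integral => //.
    - apply/measurable_EFinP; apply: measurable_funTS; exact: mpow.
    - apply: emeasurable_funD => //.
      apply/measurable_EFinP; apply: measurable_funTS; exact: mpow.
    - move=> x _; rewrite -EFinD lee_fin.
      have [x1|x1] := leP `|ft x| 1.
        rewrite (@le_trans _ _ 1)//; last by rewrite lerDr powR_ge0.
        by rewrite -[leRHS](congr1 (@^~ A^-1) (powR1 R)) ge0_ler_powR ?nnegrE
          ?invr_ge0// ltW.
      by rewrite (le_trans (ler_powR (ltW x1) Aq))// lerDl.
  rewrite ge0_integralD//=; last first.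
    by apply/measurable_EFinP; apply: measurable_funTS; exact: mpow.
  rewrite integral_cst// mul1e lte_add_pinfty//.
  apply: le_lt_trans I; apply: (@le_trans _ _ (\int[mu]_x (`|ft x| `^ q)%:E)%E).
    apply: ge0_subset_integral => //.
    by apply/measurable_EFinP; exact: mpow.
  apply: ge0_le_integral => //.
  - by apply/measurable_EFinP; exact: mpow.
  - by apply: measurableT_comp => //; apply/measurable_EFinP; exact: mpow.
  - by move=> x _; rewrite lee_fin ler_norm.
- move=> _ _; rewrite /Lp_on inE => /andP[_ /[!inE]]/=;
  rewrite /finite_norm unlock /Lnorm.
  (* The norm of infinite exponent is an essential supremum only on a space of positive measure. *)
  have -> : (0 < mu [set: R])%E.
    apply: (@lt_le_trans _ _ (mu (`[0%R, 1%R] : set R))).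
      by rewrite lebesgue_measure_itv/= lte_fin ltr01 sube0.
    by apply: le_measure; rewrite ?inE.
  move=> /ess_supr_bounded[M fM].
  apply: (@le_lt_trans _ _ (\int[mu]_(x in `[0%R, T]) (M `^ A^-1)%:E)%E).
    apply: ae_ge0_le_integral => //.
    - apply/measurable_EFinP; apply: measurable_funTS; exact: mpow.
    - by move=> x _; rewrite lee_fin powR_ge0.
    - apply: filterS fM => x/= fxM _; rewrite lee_fin ge0_ler_powR//.
      + by rewrite invr_ge0 ltW.
      + by rewrite nnegrE (le_trans _ fxM).
  by rewrite integral_cst// lte_mul_pinfty// lee_fin powR_ge0.
Qed.
End Lp_on_powers.

(** * Increments of the Volterra kernel *)

Section volterra_kernel_increment.
Context {R : realType}.
Implicit Types (a b c f g : R -> R).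
Local Notation mu := (@lebesgue_measure R).

Lemma measurable_restr0 (T t : R) f : t <= T ->
  measurable_fun setT (f \_ `[0, T]) ->
  measurable_fun setT (f \_ `[0, t]).
Proof.
move=> tT mf.
have -> : f \_ `[0, t] = (f \_ `[0, T]) \_ `[0, t].
  apply/funext => x; rewrite !patchE; case: ifPn => // /[!inE]/=.
  by rewrite !in_itv/= => /andP[x0 xt]; rewrite mem_set//= in_itv/=
    x0 (le_trans xt).
by apply/(measurable_restrictT _ _).1 => //; exact: measurable_funTS.
Qed.

(** The moving limits of integration become supports: [b] cut off at [t] supplies the upper limit,
    and [c] cut off at 0 supplies [x <= u]. An integral over the whole line results, to which
    Tonelli's theorem applies. *)
Lemma volterra_kernelE (T : R) a b c t x : x \in `[0, T] -> t \in `[0, T] ->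
  volterra_kernel a b c t x = (a \_ `[0, T]) x *
    \int[mu]_u ((b \_ `[0, t]) u * (c \_ `[0, T]) (u - x)).
Proof.
rewrite !in_itv/= => /andP[x0 xT] /andP[t0 tT].
rewrite /volterra_kernel; congr (_ * _).
  by rewrite patchE mem_set//= in_itv/= x0.
rewrite Rintegral_mkcond; apply: eq_Rintegral => u _.
rewrite !patchE; case: ifPn => [|]; rewrite ?notin_setE ?inE/= in_itv/=.
  move=> /andP[xu ut].
  by rewrite !mem_set//= in_itv/= ?subr_ge0 ?xu ?(le_trans x0 xu)//=; lra.
move=> xut; case: ifPn => [|]; rewrite ?inE/= ?mul0r// in_itv/= => /andP[u0 ut].
case: ifPn => [|]; rewrite ?inE/= ?mulr0// in_itv/= => /andP[ux _].
by exfalso; apply: xut; rewrite ut -subr_ge0 ux.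
Qed.

(** The integrand is signed and may fail to be integrable at some [x], so its positive and negative
    parts are treated separately. *)
Lemma measurable_Rintegral_conv f g : measurable_fun setT f ->
  measurable_fun setT g ->
  measurable_fun setT (fun x : measurableTypeR R => \int[mu]_u
    (f u * g (u - x))).
Proof.
move=> mf mg; rewrite /Rintegral; apply:
  (measurableT_comp (fine_measurable measurableT)).
under eq_fun do rewrite integralE.
have mfg := measurable_conv_integrand mf mg.
apply: emeasurable_funB.
- have -> : (fun x : measurableTypeR R => \int[mu]_u
  (fun v => (f v * g (v - x))%:E)^\+ u)%E =
      fubini_F mu ((fun z : R * R => (f z.2 * g (z.2 - z.1))%:E)^\+)%E.
    by apply/funext => x; apply: eq_integral => y _; rewrite !funeposE.
  apply: measurable_fun_fubini_tonelli_F => [|z]; last exact: funepos_ge0.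
  exact: measurable_funepos.
- have -> : (fun x : measurableTypeR R => \int[mu]_u
  (fun v => (f v * g (v - x))%:E)^\- u)%E =
      fubini_F mu ((fun z : R * R => (f z.2 * g (z.2 - z.1))%:E)^\-)%E.
    by apply/funext => x; apply: eq_integral => y _; rewrite !funenegE.
  apply: measurable_fun_fubini_tonelli_F => [|z]; last exact: funeneg_ge0.
  exact: measurable_funeneg.
Qed.

(** Its integral in [x] is the product of two finite [L^1] norms. The kernel over all of [[0, T]]
    dominates those over subintervals, so a single null set serves every pair of times. *)
Lemma abs_kernel_ae_fin (T : R) b c (mb mc : R) :
  measurable_fun setT b -> measurable_fun setT c ->
  (\int[mu]_(x in `[0%R, T]) (`|b x|)%:E <= mb%:E)%E ->
  (\int[mu]_(x in `[0%R, T]) (`|c x|)%:E <= mc%:E)%E ->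
  {ae mu, forall x, abs_kernel b c T 0 T x < +oo}%E.
Proof.
move=> mb_ mc_ Ib Ic.
pose bT u := `|b u| * \1_(`[0, T] : set R) u.
pose cT u := `|c u| * \1_(`[0, T] : set R) u.
have mbT : measurable_fun setT bT by apply: measurable_funM => //; exact:
  measurableT_comp.
have mcT : measurable_fun setT cT by apply: measurable_funM => //; exact:
  measurableT_comp.
have bT0 u : 0 <= bT u by exact: mulr_ge0.
have cT0 u : 0 <= cT u by exact: mulr_ge0.
have int : mu.-integrable setT (abs_kernel b c T 0 T).
  apply/integrableP; split; first exact: (measurable_conv mbT mcT).
  under eq_integral do rewrite gee0_abs ?integral_ge0//.
  have := integral_conv mbT mcT bT0 cT0; rewrite /abs_kernel => ->.
  rewrite !integral_mul_indic// lte_mul_pinfty//.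
  - by apply: integral_ge0.
  - by rewrite ge0_fin_numE ?integral_ge0// (le_lt_trans Ib)// ltry.
  - by rewrite (le_lt_trans Ic)// ltry.
have := integrable_ae measurableT int.
by apply: filterS => x /(_ I) /fin_numP[_ +]; rewrite -ltey => ->.
Qed.

Lemma measurable_abs_kernel_integrand (T v w x : R) f g :
  measurable_fun setT f -> measurable_fun setT g ->
  measurable_fun setT (fun u : R => (`|f u| * \1_(`[v, w] : set R) u *
    (`|g (u - x)| * \1_(`[0%R, T] : set R) (u - x)))%:E).
Proof.
move=> mf mg; apply/measurable_EFinP.
have mg1 : measurable_fun setT (fun u => `|g u| * \1_(`[0%R, T] : set R) u).
  by apply: measurable_funM => //; exact: measurableT_comp.
apply: measurable_funM.
  by apply: measurable_funM => //; exact: measurableT_comp.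
by apply: (measurableT_comp mg1); exact: measurable_funB.
Qed.

Lemma norm_patch_indic (T : R) c u :
  `|(c \_ `[0, T]) u| * \1_(`[0%R, T] : set R) u = `|(c \_ `[0, T]) u|.
Proof.
rewrite patchE indicE; case: ifPn => _; rewrite ?mulr1// mulr0.
by rewrite normr0.
Qed.

Lemma integrable_volterra_integrand (T : R) b c bT cT v x :
  bT = b \_ `[0, T] -> cT = c \_ `[0, T] ->
  measurable_fun setT bT -> measurable_fun setT cT ->
  v <= T -> (abs_kernel bT cT T 0 T x < +oo)%E ->
  mu.-integrable setT (EFin \o (fun u => (b \_ `[0, v]) u * cT (u - x))).
Proof.
move=> bE cE mb mc vT fin.
pose k v u := (b \_ `[0, v]) u * cT (u - x).
have mk : measurable_fun setT (k v).
  apply: measurable_funM.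
    by apply: (measurable_restr0 vT); rewrite -bE.
  by apply: (measurableT_comp mc); exact: measurable_funB.
have cTE u : `|cT u| * \1_(`[0%R, T] : set R) u = `|cT u|.
  by rewrite cE norm_patch_indic.
apply/integrableP; split; first by apply/measurable_EFinP; exact: mk.
apply: le_lt_trans fin; apply: ge0_le_integral => //.
- by apply: measurableT_comp => //; apply/measurable_EFinP.
- exact: measurable_abs_kernel_integrand.
- move=> u _ /=; rewrite lee_fin /k normrM cTE ler_wpM2r// bE !patchE indicE.
  case: ifPn => [|_]; last by rewrite normr0 mulr_ge0.
  rewrite inE/= in_itv/= => /andP[u0 uv].
  by rewrite !mem_set/= ?mulr1// in_itv/= u0 (le_trans uv).
Qed.

(** Finiteness at [x] makes both integrals subtractable, and [b] cut off at [t] minus [b] cut off at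
    [s] lives on [[s, t]]. *)
Lemma volterra_kernel_increment (T : R) a b c aT bT cT s t x :
  aT = a \_ `[0, T] -> bT = b \_ `[0, T] -> cT = c \_ `[0, T] ->
  measurable_fun setT bT -> measurable_fun setT cT ->
  0 <= s -> s <= t -> t <= T -> x \in `[0, T] ->
  (abs_kernel bT cT T 0 T x < +oo)%E ->
  (`|volterra_kernel a b c t x - volterra_kernel a b c s x|%:E <=
   `|aT x|%:E * abs_kernel bT cT T s t x)%E.
Proof.
move=> aE bE cE mb mc s0 st tT xT fin.
have t0 := le_trans s0 st; have sT := le_trans st tT.
rewrite !(@volterra_kernelE T) ?in_itv/= ?s0 ?t0// -aE -cE.
pose k v u := (b \_ `[0, v]) u * cT (u - x).
have cTE u : `|cT u| * \1_(`[0%R, T] : set R) u = `|cT u|.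
  by rewrite cE norm_patch_indic.
have ik v : v <= T -> mu.-integrable setT (EFin \o k v).
  by move=> vT; exact: (integrable_volterra_integrand bE cE).
rewrite -mulrBr normrM EFinM; apply: lee_wpmul2l; first by rewrite lee_fin.
have := @RintegralB _ _ _ mu setT (k t) (k s) measurableT (ik _ tT) (ik _ sT).
rewrite /k => <-; rewrite -/(k t _).
have ikB : mu.-integrable setT (EFin \o (fun u => k t u - k s u)).
  have := integrableB measurableT (ik _ tT) (ik _ sT).
  by apply: eq_integrable.
rewrite EFin_normr_Rintegral//.
apply: le_trans (le_abse_integral _ _ _) _ => //; first by case/integrableP:
  ikB.
apply: ge0_le_integral => //.
  by apply: measurableT_comp => //; case/integrableP: ikB.
  exact: measurable_abs_kernel_integrand.
move=> u _ /=; rewrite lee_fin /k -mulrBl normrM cTE ler_wpM2r//.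
rewrite bE !patchE indicE; have [ut|ut] := boolP (u \in _).
  have [us|us] := boolP (u \in _).
    by rewrite subrr normr0 mulr_ge0.
  move: ut us; rewrite notin_setE inE/= !in_itv/= => /andP[u0 ut] /negP.
  rewrite u0/= -ltNge => us.
  by rewrite !mem_set/= ?mulr1 ?subr0// in_itv/= ?u0 ?(ltW us)//= (le_trans ut).
rewrite (_ : u \in `[0, s]%classic = false) ?subr0 ?normr0 ?mulr_ge0//.
move: ut; rewrite notin_setE/= !in_itv/= => ut.
by apply/negP; rewrite inE/= in_itv/= => /andP[u0 us]; apply: ut;
  rewrite u0 (le_trans us).
Qed.
End volterra_kernel_increment.

Section volterra_kernel_increment_L2.
Context {R : realType}.
Implicit Types (a b c f g : R -> R).
Local Notation mu := (@lebesgue_measure R).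

Lemma ae_lebesgueS (P Q : R -> Prop) : (forall x, P x -> Q x) ->
  {ae mu, forall x, P x} -> {ae mu, forall x, Q x}.
Proof. exact: (@filterS _ _ (ae_filter_ringOfSetsType mu)). Qed.

Lemma inve_ge1 (p : \bar R) : (1 <= p)%E ->
  exists ip : R, [/\ p^-1%E = ip%:E, 0 <= ip & ip <= 1].
Proof.
case: p => [p||] //; last by move=> _; exists 0; rewrite invey.
rewrite lee_fin => p1; exists p^-1; have p0 : 0 < p by lra.
by rewrite inver gt_eqF// invr_ge0 ltW// invf_le1.
Qed.

(** Here [Q] is taken to be [B - H]. It exceeds [iq] as soon as [A + C] is close enough to the
    maximum, the least value that the constraints on [A] and [C] allow. *)
Lemma volterra_exponents (ip iq ir H : R) : 0 <= ip -> ip <= 2^-1 -> 0 <= iq ->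
  0 <= ir -> ir <= 1 -> 0 < H -> H < 3 / 2 - iq - Num.max (2^-1) (ip + ir) ->
  exists A C : R, let B := 3 / 2 - A - C in
    [/\ [/\ 0 < A, A <= 2^-1, 0 < C & C <= 1], B <= 1, 0 < B - H, ip <=
      A & ir <= C /\ iq <= B - H].
Proof.
move=> ip0 ip2 iq0 ir0 ir1 H0.
set m := Num.max _ _ => Hm.
have m1 : 2^-1 <= m by rewrite le_max lexx.
have m2 : ip + ir <= m by rewrite le_max lexx orbT.
(* A quarter of the available slack; [A + C] will exceed [m] by at most [2 * e]. The cap 1/2 keeps
   [A <= 1/2]. *)
pose e := Num.min ((3 / 2 - iq - m - H) / 4) 2^-1.
have e0 : 0 < e by rewrite lt_min; apply/andP; split; lra.
have e1 : e <= (3 / 2 - iq - m - H) / 4 by rewrite ge_min lexx.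
have e2 : e <= 2^-1 by rewrite ge_min lexx orbT.
pose A := Num.max ip e.
have A1 : ip <= A by rewrite le_max lexx.
have A2 : e <= A by rewrite le_max lexx orbT.
have A3 : A <= 2^-1 by rewrite ge_max ip2.
have A4 : A <= ip + e by rewrite ge_max; apply/andP; split; lra.
(* The term [2^-1 - A] enforces [A + C >= 1/2], that is [B <= 1]; the term [e] keeps [C] positive
   when [ir] is 0. *)
pose C := Num.max ir (Num.max (2^-1 - A) e).
have C1 : ir <= C by rewrite le_max lexx.
have C2 : 2^-1 - A <= C by rewrite !le_max lexx orbT.
have C3 : e <= C by rewrite !le_max lexx !orbT.
have C4 : C <= 1 by rewrite !ge_max; apply/and3P; split; lra.
have C5 : C <= m + 2 * e - A.
  by rewrite !ge_max; apply/and3P; split; lra.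
by exists A, C; split; [split| | |exact: A1|split]; lra.
Qed.

Lemma abs_kernel_ae_fin_Lp (T : R) (q r : \bar R) b c :
  (1 <= q)%E -> (1 <= r)%E -> Lp_on T q b -> Lp_on T r c ->
  {ae mu, forall s, (abs_kernel (b \_ `[0%R, T]) (c \_ `[0%R, T]) T 0 T s <
    +oo)%E}.
Proof.
move=> q1 r1 Lb Lc.
have [iq [iqE _ iq1]] := inve_ge1 q1; have [ir [irE _ ir1]] := inve_ge1 r1.
have [|mb] := Lp_on_integral_powR q1 (@ltr01 R) _ Lb;
  first by rewrite iqE lee_fin.
have [|mc] := Lp_on_integral_powR r1 (@ltr01 R) _ Lc;
  first by rewrite irE lee_fin.
under eq_integral do rewrite invr1 powRr1//; move=> Ic.
under eq_integral do rewrite invr1 powRr1//; move=> Ib.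
exact: (abs_kernel_ae_fin (Lp_on_measurable Lb) (Lp_on_measurable Lc) Ib Ic).
Qed.

(** Certifies that the inner integral is a genuine one for almost every [s], as the real-valued
    integral is a total operation. *)
Lemma volterra_integrand_ae_integrable (T : R) (q r : \bar R) b c :
  (1 <= q)%E -> (1 <= r)%E -> Lp_on T q b -> Lp_on T r c ->
  {ae mu, forall s, s \in `[0, T] ->
    mu.-integrable `[s, T] (fun u => (b u * c (u - s))%:E)}.
Proof.
move=> q1 r1 Lb Lc; have := abs_kernel_ae_fin_Lp q1 r1 Lb Lc.
apply: ae_lebesgueS => s fin; rewrite in_itv/= => /andP[s0 sT].
have h := integrable_volterra_integrand erefl erefl (Lp_on_measurable Lb)
  (Lp_on_measurable Lc) (lexx T) fin.
apply: eq_integrable (integrableS _ _ _ h) => // u /[!inE]/=.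
rewrite in_itv/= => /andP[su uT].
rewrite !patchE !mem_set//= in_itv/=; lra.
Qed.

Lemma measurable_volterra_kernel (T : R) (p q r : \bar R) a b c t :
  Lp_on T p a -> Lp_on T q b -> Lp_on T r c -> t \in `[0, T] ->
  measurable_fun setT (volterra_kernel a b c t \_ `[0, T]).
Proof.
move=> La Lb Lc; rewrite in_itv/= => /andP[t0 tT].
apply/(measurable_restrictT _ _).1 => //.
apply: (@eq_measurable_fun _ _ _ _ _ (fun x => (a \_ `[0, T]) x *
  \int[mu]_u ((b \_ `[0, t]) u * (c \_ `[0, T]) (u - x)))).
  by move=> x /[!inE]/= xT; rewrite (@volterra_kernelE _ T)// in_itv/= t0.
apply: measurable_funM; apply: measurable_funTS; first exact:
  Lp_on_measurable La.
apply: measurable_Rintegral_conv; last exact: Lp_on_measurable Lc.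
exact: measurable_restr0 tT (Lp_on_measurable Lb).
Qed.

Lemma volterra_kernel_increment_L2 (T : R) (p q r : \bar R) a b c
  (ip iq ir H : R) :
  0 < T -> (1 <= p)%E -> (1 <= q)%E -> (1 <= r)%E ->
  p^-1%E = ip%:E -> q^-1%E = iq%:E -> r^-1%E = ir%:E ->
  Lp_on T p a -> Lp_on T q b -> Lp_on T r c ->
  ip <= 2^-1 -> 0 < H -> H < 3 / 2 - iq - Num.max (2^-1) (ip + ir) ->
  exists2 K : R, 0 <= K & forall s t dl, 0 <= s -> s <= t -> t <= T ->
    0 < dl -> t - s <= dl ->
    (\int[mu]_(x in `[0%R, T])
      ((volterra_kernel a b c t x - volterra_kernel a b c s x) ^+ 2)%:E <=
    (K * dl `^ (2 * H))%:E)%E.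
Proof.
move=> T0 p1 q1 r1 pE qE rE La Lb Lc ip2 H0 HH.
have [ip' []] := inve_ge1 p1; rewrite pE => -[<-] ip0 _.
have [iq' []] := inve_ge1 q1; rewrite qE => -[<-] iq0 _.
have [ir' []] := inve_ge1 r1; rewrite rE => -[<-] ir0 ir1.
have [A [C [[A0 A2 C0 C1] B1 BH0 ipA [irC iqB]]]] :=
  volterra_exponents ip0 ip2 iq0 ir0 ir1 H0 HH.
have [|ma Ia] := Lp_on_integral_powR p1 A0 _ La; first by rewrite pE lee_fin.
have [|mb Ib] := Lp_on_integral_powR q1 BH0 _ Lb; first by rewrite qE lee_fin.
have [|mc Ic] := Lp_on_integral_powR r1 C0 _ Lc; first by rewrite rE lee_fin.
have mea := Lp_on_measurable La; have meb := Lp_on_measurable Lb.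
have mec := Lp_on_measurable Lc.
have [|K K0 HK] := kernel_L2_bound A0 A2 C0 C1 erefl B1 BH0 _ T0 mea meb mec Ia
  Ib Ic.
  by lra.
exists K => // s t dl s0 st tT dl0 tsdl.
have := HK s t dl s0 st tT dl0 tsdl.
rewrite (_ : 3 / 2 - A - C - (3 / 2 - A - C - H) = H); last by ring.
apply: le_trans.
have mK v : v \in `[0, T] -> measurable_fun `[0, T] (volterra_kernel a b c v).
  move=> vT; apply/(measurable_restrictT _ _).2 => //.
  exact: (measurable_volterra_kernel La Lb Lc).
have tT' : t \in `[0, T] by rewrite in_itv/= (le_trans s0 st).
have sT' : s \in `[0, T] by rewrite in_itv/= s0 (le_trans st tT).
have ab0 x : (0 <= abs_kernel (b \_ `[0%R, T]) (c \_ `[0%R, T]) T s t x)%E.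
  apply: integral_ge0 => u _; rewrite lee_fin mulr_ge0// mulr_ge0//.
apply: ae_ge0_le_integral => //.
- by move=> x _; rewrite lee_fin sqr_ge0.
- apply/measurable_EFinP; apply: measurable_funX; apply: measurable_funB; exact:
  mK.
- by move=> x _; rewrite mule_ge0 ?lee_fin ?sqr_ge0// mule_ge0.
- apply: emeasurable_funM.
    by apply/measurable_EFinP; apply: measurable_funX; exact: measurable_funTS.
  apply: measurable_funTS.
  have mabs := measurable_conv (f := fun u => `|(b \_ `[0, T]) u| *
    \1_(`[s, t] : set R) u)
    (g := fun u => `|(c \_ `[0, T]) u| * \1_(`[0, T] : set R) u).
  by apply: emeasurable_funM; apply: mabs => //;
    try (by move=> u; exact: mulr_ge0);
    apply: measurable_funM => //; exact: measurableT_comp.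
have := abs_kernel_ae_fin_Lp q1 r1 Lb Lc.
apply: ae_lebesgueS => x fin xT.
have := volterra_kernel_increment erefl erefl erefl meb mec s0 st tT xT fin
  (a := a).
have := ab0 x; case: (abs_kernel _ _ T s t x) => [n||] // n0.
- move=> le1; rewrite -EFinM lee_fin in le1; rewrite -!EFinM lee_fin.
  rewrite -real_normK ?num_real// [leRHS](_ : _ = (`|(a \_ `[0, T]) x| * n) ^+
    2).
    by rewrite ler_pXn2r ?nnegrE// mulr_ge0.
  by rewrite exprMn real_normK ?num_real.
(* Where the dominating kernel is infinite, either [a] vanishes and, by the convention that 0 times
   infinity is 0, so does the increment, or the right-hand side is infinite. *)
- have [->|a0] := eqVneq ((a \_ `[0, T]) x) 0.
    by rewrite normr0 !mul0e lee_fin normr_le0 => /eqP ->;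
      rewrite expr0n !mul0e.
  by move=> _; rewrite mulyy gt0_muley ?leey// lte_fin exprn_even_gt0.
Qed.
End volterra_kernel_increment_L2.

Section volterra_kernel_Lp.
Context {R : realType}.
Implicit Types (a b c f g : R -> R).
Local Notation mu := (@lebesgue_measure R).

(** Allows the kernels of all times [t] to be compared on the common interval [[0, T]]. *)
Lemma volterra_kernel_support a b c (t x : R) : t <= x ->
  volterra_kernel a b c t x = 0.
Proof.
move=> tx; rewrite /volterra_kernel; case: (eqVneq t x) => [->|tNx].
  by rewrite set_itv1 Rintegral_set1 mulr0.
rewrite set_itv_ge ?Rintegral_set0 ?mulr0//.
by rewrite bnd_simp -ltNge lt_neqAle tNx.
Qed.

(** Positivity of the critical exponent has two sources: [1 < q] for the branch 1/2 of the maximum,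
    and the bound on the sum of the inverses for the other branch. *)
Lemma holder_exponentsE (p q r : \bar R) :
  (2%:E <= p)%E -> (1 < q)%E -> (1 <= r)%E ->
  (p^-1 + q^-1 + r^-1 < (3 / 2)%:E)%E ->
  exists ip iq ir : R,
  [/\ [/\ p^-1%E = ip%:E, q^-1%E = iq%:E & r^-1%E = ir%:E], ip <= 2^-1,
    0 < 3 / 2 - iq - Num.max (2^-1) (ip + ir) &
    ((3 / 2)%:E - q^-1 - maxe (2^-1)%:E (p^-1 + r^-1) =
      (3 / 2 - iq - Num.max (2^-1) (ip + ir))%:E)%E].
Proof.
move=> p2 q1 r1; have p1 : (1 <= p)%E by rewrite (le_trans _ p2)// lee_fin
  ler1n.
have [ip [pE ip0 _]] := inve_ge1 p1.
have [iq [qE iq0 _]] := inve_ge1 (ltW q1).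
have [ir [rE ir0 _]] := inve_ge1 r1.
rewrite pE qE rE -!EFinD lte_fin => lt32.
have ip2 : ip <= 2^-1.
  move: p2 pE; case: (p) => [x||] //; last by rewrite invey => _ [<-]; lra.
  rewrite lee_fin => x2; have x0 : 0 < x by lra.
  by rewrite inver gt_eqF// => -[<-]; rewrite lef_pV2// posrE.
have iq1 : iq < 1.
  move: q1 qE; case: (q) => [x||] //; last by rewrite invey => _ [<-]; lra.
  rewrite lte_fin => x1; have x0 : 0 < x by lra.
  by rewrite inver gt_eqF// => -[<-]; rewrite invf_lt1.
exists ip, iq, ir; split=> //; last by rewrite -EFin_max -!EFinB.
by rewrite subr_gt0 gt_max; apply/andP; split; lra.
Qed.

(** The kernel at time 0 vanishes on [[0, T]], so the increment bound between the times 0 and [t],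
    taken at scale [T], bounds the kernel itself. Any admissible exponent would do; half the
    critical one is used. *)
Lemma volterra_kernel_Lp (T : R) (p q r : \bar R) a b c t :
  0 < T -> (2%:E <= p)%E -> (1 < q)%E -> (1 <= r)%E ->
  (p^-1 + q^-1 + r^-1 < (3 / 2)%:E)%E ->
  Lp_on T p a -> Lp_on T q b -> Lp_on T r c -> t \in `[0, T] ->
  Lp_on t 2%:E (volterra_kernel a b c t).
Proof.
move=> T0 p2 q1 r1 pqr La Lb Lc tT.
have p1 : (1 <= p)%E by rewrite (le_trans _ p2)// lee_fin ler1n.
have [ip [iq [ir [[pE qE rE] ip2 H0 _]]]] := holder_exponentsE p2 q1 r1 pqr.
set h := 3 / 2 - iq - _ in H0.
have [||K K0 HK] := volterra_kernel_increment_L2 T0 p1 (ltW q1) r1 pE qE rE La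
  Lb Lc ip2 (H := h / 2).
- by rewrite divr_gt0.
- by rewrite -/h; lra.
have := tT; rewrite in_itv/= => /andP[t0 tT'].
have := HK 0 t T (lexx _) t0 tT' T0; rewrite subr0 => /(_ tT') HKt.
have mK := measurable_volterra_kernel La Lb Lc tT.
have KE : volterra_kernel a b c t \_ `[0, t] =
  volterra_kernel a b c t \_ `[0, T].
  apply/funext => x; rewrite !patchE; case: ifPn => [|xt].
    rewrite inE/= in_itv/= => /andP[x0 xt].
    by rewrite mem_set//= in_itv/= x0 (le_trans xt).
  case: ifPn => //; rewrite inE/= in_itv/= => /andP[x0 xT].
  rewrite volterra_kernel_support//; move: xt; rewrite notin_setE/= in_itv/=
    x0/=.
  by move=> /negP; rewrite -ltNge => /ltW.
rewrite /Lp_on KE inE; apply/andP; rewrite !inE/=; split => //.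
rewrite /finite_norm unlock /Lnorm poweR_lty//.
apply: (@le_lt_trans _ _ (K * T `^ (2 * (h / 2)))%:E); last exact: ltry.
apply: le_trans HKt; rewrite [leRHS]integral_mkcond.
rewrite le_eqVlt; apply/orP; left; apply/eqP; apply: eq_integral => x _.
rewrite /= !patchE; case: ifPn => [|_]; last by rewrite normr0 powR0.
rewrite inE/= in_itv/= => /andP[x0 xT].
rewrite (volterra_kernel_support _ _ _ x0) subr0 powR_mulrn// real_normK//.
exact: num_real.
Qed.
End volterra_kernel_Lp.

(** * Gaussian tails *)

Section independence.
Context {d : measure_display} {Omega : measurableType d} {R : realType}.
Variable P : probability Omega R.

Lemma expectation_prod_independent (n : nat) (X : 'I_n -> Omega -> R)
    (phi : 'I_n -> R -> R) (m : 'I_n -> R) :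
  (forall i, measurable_fun setT (X i)) ->
  (forall i, measurable_fun setT (phi i)) -> (forall i x, 0 <= phi i x) ->
  (forall i, \int[P]_w (phi i (X i w))%:E = (m i)%:E)%E ->
  mutually_independent P X ->
  (\int[P]_w (\prod_(i < n) phi i (X i w))%:E = (\prod_(i < n) m i)%:E)%E.
Proof.
move=> mX mphi phi0 Em indX.
have mpre i (B : set (measurableTypeR R)) : measurable B ->
  measurable (X i @^-1` B).
  by move=> mB; rewrite -[X in measurable X]setTI; exact: mX.
pose F (k : nat) (B : 'I_n -> set R) (i : 'I_n) (x : R) : R :=
  if (i < k)%N then phi i x else \1_(B i) x.
pose c (k : nat) (B : 'I_n -> set R) (i : 'I_n) : R :=
  if (i < k)%N then m i else fine (P (X i @^-1` B i)).
have mF k B i : (forall i, measurable (B i : set (measurableTypeR R))) ->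
    measurable_fun setT (F k B i).
  by move=> mB; rewrite /F; case: (i < k)%N;
    [exact: mphi|apply: measurable_indic; exact: mB].
have F0 k B i x : 0 <= F k B i x by rewrite /F; case: (i < k)%N.
have m0 i : 0 <= m i.
  by rewrite -lee_fin -Em; apply: integral_ge0 => w _; rewrite lee_fin.
have c0 k B i : 0 <= c k B i by rewrite /c; case: (i < k)%N => //; exact:
  fine_ge0.
(* The indicators of the events are replaced by the functions [phi i] one at a
   time. *)
have claim k : (k <= n)%N -> forall B : 'I_n -> set (measurableTypeR R),
    (forall i, measurable (B i)) ->
    (\int[P]_w (\prod_(i < n) F k B i (X i w))%:E =
      (\prod_(i < n) c k B i)%:E)%E.
  elim: k => [_ B mB|k IH kn B mB].
    transitivity (\int[P]_w (\1_(\bigcap_(i in [set: 'I_n]) (X i @^-1` B i))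
      w)%:E)%E.
      apply: eq_integral => w _; congr (_%:E).
      rewrite /F/= indicE; have [h|h] := boolP (w \in _).
        rewrite big1// => i _; rewrite indicE mem_set//.
        by move: h; rewrite inE => /(_ i I).
      have [i Bi] : exists i, ~ B i (X i w).
        by apply/existsNP => h'; move: h; rewrite notin_setE; apply => i _;
          exact: h'.
      by rewrite (bigD1 i)//= indicE memNset// mul0r.
    rewrite integral_indic//; last first.
      by apply: fin_bigcap_measurable => // i _; exact: mpre.
    rewrite setIT -prodEFin; transitivity (\prod_(i < n) P (X i @^-1` B i))%E.
      exact: indX.
    by apply: eq_bigr => i _; rewrite fineK// fin_num_measure//; exact: mpre.
  pose j := Ordinal kn.
  have lt_k (i : 'I_n) : i != j -> (i < k.+1)%N = (i < k)%N.
    move=> ij; rewrite ltnS leq_eqVlt (_ : (i == k :> nat) = false)//.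
    exact/negbTE.
  have mPsi : measurable_fun setT (fun w => \prod_(i < n | i != j) F k B i
    (X i w)).
    under eq_fun do rewrite big_mkcond.
    apply: measurable_prod => i _; case: (i != j) => //.
    exact: measurableT_comp (mF _ _ _ mB) (mX i).
  have cPsi0 : 0 <= \prod_(i < n | i != j) c k B i by apply: prodr_ge0.
  have := @ge0_integral_transfer _ _ _ _ _ _ _ P P (X j) (X j)
    (fun w => \prod_(i < n | i != j) F k B i (X i w))
    (cst (\prod_(i < n | i != j) c k B i)) (EFin \o phi j) (mX j) (mX j) mPsi.
  move=> transfer.
  transitivity (\int[P]_w ((\prod_(i < n | i != j) F k B i (X i w))%:E *
      (EFin \o phi j) (X j w)))%E.
    apply: eq_integral => w _; rewrite (bigD1 j)//= mulrC EFinM;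
      congr (_ * _)%E.
      by congr (_%:E); apply: eq_bigr => i ij; rewrite /F lt_k.
    by rewrite /F/= ltnSn.
  have psi0 w : 0 <= \prod_(i < n | i != j) F k B i (X i w) by apply: prodr_ge0.
  have mphiE : measurable_fun setT (EFin \o phi j) by exact/measurable_EFinP.
  have phiE0 x : (0 <= (EFin \o phi j) x)%E by rewrite lee_fin.
  have mphiX : measurable_fun setT (fun w => (phi j (X j w))%:E).
    by apply/measurable_EFinP; exact: measurableT_comp (mphi j) (mX j).
  have phiX0 w : setT w -> (0 <= (phi j (X j w))%:E)%E by rewrite lee_fin.
  rewrite (transfer (measurable_cst _) psi0 (fun=> cPsi0) mphiE phiE0).
    transitivity (\int[P]_w ((\prod_(i < n | i != j) c k B i)%:E *
      (phi j (X j w))%:E))%E; first by [].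
    rewrite ge0_integralZl//= Em -EFinM mulrC [in RHS](bigD1 j)//= {2}/c ltnSn.
    by congr (_ * _)%:E; apply: eq_bigr => i ij; rewrite /c lt_k.
  move=> B' mB'.
  (* To trade the other factors for a constant, the claim must be known with the indicator of an
     arbitrary [B'] in place [j]. This is the induction hypothesis for a modified family, hence the
     quantification over all [B]. *)
  pose B2 i := if i == j then B' else B i.
  have mB2 i : measurable (B2 i) by rewrite /B2; case: (i == j);
    [exact: mB'|exact: mB].
  transitivity (\int[P]_w (\prod_(i < n) F k B2 i (X i w))%:E)%E.
    apply: eq_integral => w _; rewrite [in RHS](bigD1 j)//= mulrC EFinM;
      congr (_ * _)%E.
      by congr (_%:E); apply: eq_bigr => i ij; rewrite /F /B2 (negbTE ij).
    by rewrite /F ltnn /B2 eqxx.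
  rewrite IH//; last exact: ltnW.
  have mind : measurable_fun setT (fun w => (\1_B' (X j w))%:E : \bar R).
    apply/measurable_EFinP; apply: measurableT_comp (mX j).
    exact: measurable_indic.
  transitivity (\int[P]_w ((\prod_(i < n | i != j) c k B i)%:E *
      (\1_B' (X j w))%:E))%E; last by [].
  rewrite ge0_integralZl//=.
  rewrite (_ : (\int[P]_w _)%E = P (X j @^-1` B')); last first.
    have := integral_indic P measurableT (mpre j B' mB'); rewrite setIT => <-.
    exact: eq_integral.
  rewrite (bigD1 j)//= {1}/c ltnn /B2 eqxx mulrC EFinM fineK; last first.
    by rewrite fin_num_measure//; exact: mpre.
  by congr (_%:E * _)%E; apply: eq_bigr => i ij; rewrite /c (negbTE ij).
have := claim n (leqnn n) (fun=> setT) (fun=> measurableT).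
rewrite /F /c; under eq_integral do under eq_bigr do rewrite ltn_ord.
by under eq_bigr do rewrite ltn_ord.
Qed.
End independence.

Section wiener_mgf.
Context {d : measure_display} {Omega : measurableType d} {R : realType}.
Variable P : probability Omega R.
Local Notation mu := (@lebesgue_measure R).

(** Completing the square: tilting the centred density by [expR (theta * x)] gives, up to a constant
    factor, the density with mean [theta * sigma ^+ 2]. *)
Lemma normal_mgf (sigma theta : R) : sigma != 0 ->
  (\int[mu]_x ((normal_pdf 0 sigma x)%:E * (expR (theta * x))%:E) =
   (expR (theta ^+ 2 * sigma ^+ 2 / 2))%:E)%E.
Proof.
move=> s0.
transitivity (\int[mu]_x ((expR (theta ^+ 2 * sigma ^+ 2 / 2))%:E *
    (normal_pdf (theta * sigma ^+ 2) sigma x)%:E))%E.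
  apply: eq_integral => x _; rewrite !normal_pdfE// -!EFinM; congr (_%:E).
  rewrite [RHS]mulrCA -[LHS]mulrA; congr (_ * _).
  rewrite /normal_fun -!expRD; congr expR.
  by field.
rewrite ge0_integralZl//.
- by rewrite integral_normal_pdf mule1.
- by apply/measurable_EFinP; exact: measurable_normal_pdf.
- by move=> x _; rewrite lee_fin normal_pdf_ge0.
Qed.

Lemma wiener_increment_mgf (W : R -> {RV P >-> R}) (s t theta : R) :
  wiener_process W -> 0 <= s -> s <= t ->
  (\int[P]_w (expR (theta * (W t w - W s w)))%:E =
   (expR (theta ^+ 2 * (t - s) / 2))%:E)%E.
Proof.
move=> [_ _ hN _] s0; rewrite le_eqVlt => /predU1P[<-|st].
  rewrite subrr mulr0 mul0r expR0.
  under eq_integral do rewrite subrr mulr0 expR0.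
  rewrite integral_cst// mul1e. exact: probability_setT.
have sig0 : Num.sqrt (t - s) != 0 by rewrite gt_eqF// sqrtr_gt0 subr_gt0.
have := normal_mgf theta sig0; rewrite sqr_sqrtr ?subr_ge0 ?(ltW st)// => <-.
have mD : measurable_fun setT (fun w => W t w - W s w : measurableTypeR R).
  exact: measurable_funB.
have := @ge0_integral_transfer _ _ _ _ _ _ _ P mu _ id (cst 1)
  (normal_pdf 0 (Num.sqrt (t - s)))
  (fun x => (expR (theta * x))%:E) mD (@measurable_id _ _ _) (measurable_cst _)
  (measurable_normal_pdf _ _) (fun=> ler01) (normal_pdf_ge0 _ _).
under eq_integral do rewrite mul1e; apply => //.
- apply/measurable_EFinP; apply: measurableT_comp => //.
- move=> B mB.
  under eq_integral do rewrite mul1e.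
  transitivity (P ((fun w => W t w - W s w) @^-1` B)).
    have mDB : measurable ((fun w => W t w - W s w) @^-1` B).
      by rewrite -[X in measurable X]setTI; exact: mD.
    by have := integral_indic P measurableT mDB; rewrite setIT => <-; exact:
      eq_integral.
  rewrite hN// /normal_prob [LHS]integral_mkcond; apply: eq_integral => x _.
  by rewrite patchE indicE; case: ifP; rewrite ?mule1 ?mule0.
Qed.
End wiener_mgf.

(** * Step functions and their Wiener integrals *)

Section step_functions.
Context {R : realType}.
Local Notation mu := (@lebesgue_measure R).
Implicit Type h : seq (R * (R * R)).

(* The identity holds for every [phi] so as to cover both the step integral
   ([phi t = W t w]) and the step function at [x] ([phi t = (x <= t)]). *)
Lemma step_on_refine (T : R) h : 0 <= T -> step_on T h ->
  exists (n : nat) (u y : nat -> R),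
    [/\ 0 <= u 0%N, forall i, (i < n)%N -> u i <= u i.+1,
        forall i, (i <= n)%N -> u i <= T &
        forall phi : R -> R, \sum_(k <- h) k.1 * (phi k.2.2 - phi k.2.1) =
          \sum_(i < n) y i * (phi (u i.+1) - phi (u i))].
Proof.
move=> T0 /allP hT.
(* The leading 0 keeps the list of breakpoints nonempty. *)
pose e := 0 :: flatten [seq [:: k.2.1; k.2.2] | k <- h].
pose s := sort <=%R e.
have eT x : x \in e -> 0 <= x <= T.
  rewrite inE => /predU1P[->|/flatten_mapP[k /hT /and3P[k1 k2 k3]]];
    first by rewrite lexx.
  rewrite !inE => /orP[] /eqP ->; first by rewrite k1 (le_trans k2).
  by rewrite k3 (le_trans k1).
have sT x : x \in s -> 0 <= x <= T by rewrite mem_sort; exact: eT.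
have ss : sorted <=%R s by apply: sort_sorted; exact: le_total.
have s0 : (0 < size s)%N by rewrite size_sort.
pose u i := nth 0 s i.
have u_mono i j : (i <= j)%N -> (j < size s)%N -> u i <= u j.
  by move=> ij js; apply: sorted_leq_nth => //;
    [exact: le_trans|rewrite inE (leq_ltn_trans ij)].
pose ia (k : R * (R * R)) := index k.2.1 s.
pose ib (k : R * (R * R)) := index k.2.2 s.
have mems k : k \in h -> (k.2.1 \in s) && (k.2.2 \in s).
  move=> kh; rewrite !mem_sort !inE; apply/andP; split; apply/orP; right;
  by apply/flatten_mapP; exists k => //; rewrite !inE eqxx ?orbT.
(* The coefficient of a cell collects those of all intervals that cover it; each interval is
   recovered as a telescoping sum over its cells. *)
exists (size s).-1, u, (fun i => \sum_(k <- h) k.1 *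
  ((ia k <= i) && (i < ib k))%N%:R).
split.
- by have /andP[] := sT (u 0%N) (mem_nth _ s0).
- by move=> i isz; apply: u_mono => //; rewrite -(ltn_predK s0) ltnS.
- move=> i isz; have isz' : (i < size s)%N by rewrite -(ltn_predK s0) ltnS.
  by have /andP[] := sT (u i) (mem_nth _ isz').
move=> phi; under [RHS]eq_bigr do rewrite mulr_suml.
rewrite exchange_big/= !big_seq; apply: eq_bigr => k kh.
have /andP[ma mb] := mems k kh.
have /and3P[k1 k2 k3] := hT k kh.
have iab : (ia k <= ib k)%N.
  (* Breakpoints may repeat and [index] returns the first occurrence, but reversed indices would
     force equal endpoints and hence equal indices. *)
  rewrite leqNgt; apply/negP => iba.
  have := u_mono _ _ (ltnW iba); rewrite index_mem => /(_ ma).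
  rewrite /u !nth_index// => k21.
  have e12 : k.2.1 = k.2.2 by apply/eqP; rewrite eq_le k2.
  by move: iba; rewrite /ia /ib e12 ltnn.
under [RHS]eq_bigr do rewrite -mulrA.
rewrite -mulr_sumr; congr (_ * _).
rewrite -[in LHS](nth_index 0 ma) -[in LHS](nth_index 0 mb) -/(ia k) -/(ib k)
  -/(u _) -/(u _).
rewrite -(telescope_sumr (fun i => phi (u i)) iab).
have ibn : (ib k <= (size s).-1)%N by rewrite -ltnS (ltn_predK s0) index_mem.
rewrite -(big_mkord predT (fun i => ((ia k <= i) && (i < ib k))%N%:R *
  (phi (u i.+1) - phi (u i)))).
rewrite [RHS](big_cat_nat (n := ia k)) ?(leq_trans iab)//=.
rewrite [X in _ = X + _]big1_seq ?add0r; last first.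
  move=> i; rewrite mem_index_iota => /andP[_ /andP[_ ik]].
  by rewrite leqNgt ik/= mul0r.
rewrite [RHS](big_cat_nat (n := ib k))//= [X in _ = _ + X]big1_seq ?addr0;
  last first.
  move=> i; rewrite mem_index_iota => /andP[_ /andP[ik _]].
  by rewrite [(i < _)%N]ltnNge ik andbF mul0r.
rewrite !big_seq; apply: eq_bigr => i; rewrite mem_index_iota => ->.
by rewrite mul1r.
Qed.

(** Consecutive half-open cells are disjoint, so every cross term vanishes. *)
Lemma sqr_sum_disjoint_steps (n : nat) (u y : nat -> R) (x : R) :
  (forall i, (i < n)%N -> u i <= u i.+1) ->
  (\sum_(i < n) y i * \1_(`]u i, u i.+1] : set R) x) ^+ 2 =
  \sum_(i < n) y i ^+ 2 * \1_(`]u i, u i.+1] : set R) x.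
Proof.
elim: n => [|n IH] um; first by rewrite !big_ord0 expr0n.
rewrite !big_ord_recr/= sqrrD IH; last by move=> i ilt; apply: um; exact: ltnW.
have u_mono i j : (i <= j <= n.+1)%N -> u i <= u j.
  elim: j => [|j IHj]; first by rewrite leqn0 andbT => /eqP ->.
  rewrite leq_eqVlt => /andP[/predU1P[-> //|ij jn]].
  rewrite ltnS in ij; apply: (le_trans (IHj _)); last exact: um.
  by rewrite ij ltnW.
have -> : (\sum_(i < n) y i * \1_(`]u i, u i.+1] : set R) x) *
    (y n * \1_(`]u n, u n.+1] : set R) x) = 0.
  rewrite mulr_suml big1// => i _; rewrite !indicE.
  have [|] := boolP (x \in (`]u n, _] : set R)%classic); last by rewrite !mulr0.
  rewrite inE/= in_itv/= => /andP[nx _].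
  rewrite memNset ?mulr0 ?mul0r//= in_itv/= => /andP[_ xi].
  have := u_mono i.+1 n; rewrite ltn_ord leqnSn => /(_ isT) h.
  by have := lt_le_trans nx (le_trans xi h); rewrite ltxx.
rewrite mul0rn addr0 exprMn; congr (_ + _ * _).
by rewrite indicE; case: (_ \in _); rewrite ?expr1n ?expr0n.
Qed.
End step_functions.

Section step_tail.
Context {d : measure_display} {Omega : measurableType d} {R : realType}.
Variable P : probability Omega R.
Local Notation mu := (@lebesgue_measure R).
Implicit Type h : seq (R * (R * R)).

(** On the refined partition the integral is a sum of independent Gaussian increments, so its
    exponential moment factors. The total variance is the integral of the squared step function, as
    in the Itô isometry. *)
Lemma step_integral_mgf (W : R -> {RV P >-> R}) (T V theta : R) h :
  wiener_process W -> 0 <= T -> step_on T h ->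
  (\int[mu]_(x in `[0%R, T]) (step_fun h x ^+ 2)%:E <= V%:E)%E ->
  (\int[P]_w (expR (theta * step_integral W h w))%:E <=
   (expR (theta ^+ 2 * V / 2))%:E)%E.
Proof.
move=> hW T0 hT hV.
have [n [u [y [u0 um uT hE]]]] := step_on_refine T0 hT.
have u_ge0 i : (i <= n)%N -> 0 <= u i.
  elim: i => // i IH ilt; rewrite (le_trans (IH (ltnW ilt)))// um//.
have [_ hI _ _] := hW.
have SE w : step_integral W h w = \sum_(i < n) y i * (W (u i.+1) w - W (u i) w).
  exact: (hE (fun t => W t w)).
have sE x : step_fun h x = \sum_(i < n) y i * \1_(`]u i, u i.+1] : set R) x.
  have indE (v w : R) : v <= w -> \1_(`]v, w] : set R) x =
    (x <= w)%R%:R - (x <= v)%R%:R :> R.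
    move=> vw; rewrite indicE; case: (leP x v) => xv; last first.
      rewrite subr0; congr (_%:R); congr nat_of_bool; apply/idP/idP;
        rewrite inE/= in_itv/=; lra.
    by rewrite (le_trans xv vw) subrr memNset//= in_itv/=; lra.
  rewrite /step_fun big_seq; under eq_bigr => k kh.
    have /allP/(_ _ kh)/and3P[_ k12 _] := hT.
    rewrite (indE _ _ k12); over.
  rewrite -big_seq (hE (fun t => (x <= t)%R%:R)).
  by apply: eq_bigr => i _; rewrite indE// um.
have sig : \sum_(i < n) y i ^+ 2 * (u i.+1 - u i) <= V.
  rewrite -lee_fin; apply: le_trans hV.
  under eq_integral do rewrite sE (sqr_sum_disjoint_steps _ _ um) -sumEFin.
  rewrite ge0_integral_sum//; last 2 first.
  - move=> i; apply/measurable_EFinP; apply: measurable_funTS.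
    by apply: measurable_funM => //; exact: measurable_indic.
  - by move=> i x _; rewrite lee_fin mulr_ge0 ?sqr_ge0.
  rewrite -sumEFin; apply: lee_sum => i _.
  under eq_integral do rewrite EFinM.
  rewrite ge0_integralZl//; last 2 first.
  - by apply/measurable_EFinP; apply: measurable_funTS; exact: measurable_indic.
  - by rewrite lee_fin sqr_ge0.
  rewrite integral_indic//= (_ : _ `&` _ = `]u i, u i.+1]%classic); last first.
    apply/setIidl => x /=; rewrite !in_itv/= => /andP[ux xu].
    rewrite (le_trans (u_ge0 i (ltnW (ltn_ord i))) (ltW ux)).
    by rewrite (le_trans xu)// uT.
  rewrite lebesgue_measure_itv/= lte_fin; case: ltP => uu.
    by rewrite -EFinB -EFinM.
  by rewrite mule0 lee_fin mulr_ge0_le0 ?sqr_ge0// subr_le0.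
apply: (@le_trans _ _ (expR (theta ^+ 2 *
  (\sum_(i < n) y i ^+ 2 * (u i.+1 - u i)) / 2))%:E).
  have := @expectation_prod_independent _ _ _ P n
    (fun i w => W (u i.+1) w - W (u i) w)
    (fun i x => expR (theta * y i * x))
      (fun i => expR ((theta * y i) ^+ 2 * (u i.+1 - u i) / 2)).
  move=> hprod.
  under eq_integral => w _.
    rewrite SE mulr_sumr expR_sum.
    over.
  rewrite (_ : (\int[P]_w _)%E = (\int[P]_w (\prod_(i < n)
      expR (theta * y i * (W (u i.+1) w - W (u i) w)))%:E)%E); last first.
    by apply: eq_integral => w _; under eq_bigr do rewrite mulrA.
  rewrite hprod.
  - rewrite -expR_sum lee_fin ler_expR le_eqVlt mulr_sumr mulr_suml.
    by apply/orP; left; apply/eqP/eq_bigr => i _; rewrite exprMn -!mulrA.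
  - by move=> i; exact: measurable_funB.
  - by move=> i; apply: measurableT_comp => //; exact: measurable_funM.
  - by move=> i x; exact: expR_ge0.
  - by move=> i; rewrite wiener_increment_mgf ?um ?u_ge0 ?(ltnW (ltn_ord i)).
  - by apply: hI => // i ilt; exact: um.
by rewrite lee_fin ler_expR ler_wpM2r// ler_wpM2l// sqr_ge0.
Qed.

Lemma step_integral_measurable (W : R -> {RV P >-> R}) h :
  measurable_fun setT (step_integral W h).
Proof.
rewrite /step_integral; apply: measurable_sum => k.
by apply: measurable_funM => //; exact: measurable_funB.
Qed.

(** The exponential Markov inequality at [theta = 1 / sqrt V], where the moment is at most
    [expR (2^-1)]; the factor 2 accounts for the two signs. The bound is linear in the exponent, not
    Gaussian, which is enough for summability. *)
Lemma step_integral_tail (W : R -> {RV P >-> R}) (T V z : R) h :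
  wiener_process W -> 0 <= T -> step_on T h -> 0 < V ->
  (\int[mu]_(x in `[0%R, T]) (step_fun h x ^+ 2)%:E <= V%:E)%E ->
  (P [set w | (z <= `|step_integral W h w|)%R] <=
   (2 * expR (2^-1) * expR (- (z / Num.sqrt V)))%:E)%E.
Proof.
move=> hW T0 hT V0 hV; set S := step_integral W h.
have mS : measurable_fun setT S by exact: step_integral_measurable.
pose th := (Num.sqrt V)^-1.
have th0 : 0 < th by rewrite invr_gt0 sqrtr_gt0.
have th2 : th ^+ 2 * V / 2 = 2^-1.
  by rewrite exprVn sqr_sqrtr ?(ltW V0)// mulVf ?mul1r// gt_eqF.
have mA : measurable [set w | (z <= `|S w|)%R] by exact: measurable_norm_ge.
have mE t : measurable_fun setT (fun w => (expR (t * S w))%:E).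
  apply/measurable_EFinP; apply: measurableT_comp => //; exact: measurable_funM.
have E0 t w : setT w -> (0 <= (expR (t * S w))%:E)%E by rewrite lee_fin
  expR_ge0.
have := integral_indic P measurableT mA; rewrite setIT => <-.
apply: (@le_trans _ _ (\int[P]_w ((expR (- (z / Num.sqrt V)))%:E *
    ((expR (th * S w))%:E + (expR (- th * S w))%:E)))%E).
  apply: ge0_le_integral => //.
  - by apply/measurable_EFinP; exact: measurable_indic.
  - by apply: measurable_funeM; exact: emeasurable_funD.
  - move=> w _; rewrite -EFinD -EFinM lee_fin mulrDr -!expRD -/th indicE.
    have [|_] := boolP (w \in _); last by rewrite addr_ge0 ?expR_ge0.
    rewrite inE/= => zS; have [S0|S0] := leP 0 (S w).
      rewrite (ger0_norm S0) in zS; apply: ler_wpDr; first exact: expR_ge0.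
      by rewrite -[leLHS]expR0 ler_expR mulrC -mulrN -mulrDr mulr_ge0
        ?(ltW th0)//; lra.
    rewrite (ltr0_norm S0) in zS; apply: ler_wpDl; first exact: expR_ge0.
    by rewrite -[leLHS]expR0 ler_expR mulrC mulNr -mulrN -mulrN -mulrDr mulr_ge0
      ?(ltW th0)//; lra.
rewrite ge0_integralZl//; last 2 first.
- exact: emeasurable_funD.
- by move=> w _; rewrite adde_ge0 ?E0.
rewrite ge0_integralD// (mulrC (2 * _)) EFinM; apply: lee_wpmul2l;
  first by rewrite lee_fin expR_ge0.
rewrite mulr_natl mulr2n EFinD; apply: leeD.
  by have := step_integral_mgf th hW T0 hT hV; rewrite th2.
by have := step_integral_mgf (- th) hW T0 hT hV; rewrite sqrrN th2.
Qed.
End step_tail.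

(** * Passage of the tail bound to [L^2] limits *)

Section L2_tools.
Local Open Scope ereal_scope.

Lemma Lnorm2_near_le d (T : measurableType d) (R : realType)
    (m : {measure set T -> \bar R}) (F : nat -> T -> R) :
  'N[m]_(2%:E)[EFin \o F n] @[n --> \oo] --> 0 ->
  forall e : R, (0 < e)%R ->
    \forall n \near \oo, \int[m]_x (F n x ^+ 2)%:E <= e%:E.
Proof.
move=> cv e e0.
have se0 : (0 < Num.sqrt e)%R by rewrite sqrtr_gt0.
have lt : \forall n \near \oo, 'N[m]_(2%:E)[EFin \o F n] < (Num.sqrt e)%:E.
  exact: (cv _ (@nbhs_open_ereal_lt R 0%R (fun=> Num.sqrt e) se0)).
near=> n.
have Nn : 'N[m]_(2%:E)[EFin \o F n] < (Num.sqrt e)%:E by near: n.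
have -> : \int[m]_x (F n x ^+ 2)%:E = 'N[m]_(2%:E)[EFin \o F n] `^ 2.
  rewrite poweR_Lnorm ?pnatr_eq0//; apply: eq_integral => x _ /=.
  by rewrite powR_mulrn// real_normK ?num_real.
have -> : e%:E = (Num.sqrt e)%:E `^ 2.
  by rewrite poweR_EFin powR_mulrn// sqr_sqrtr// ltW.
by apply: gt0_ler_poweR; rewrite ?in_itv/=
  ?leey ?andbT ?Lnorm_ge0 ?lee_fin ?(ltW Nn)// ltW.
Unshelve. all: by end_near.
Qed.

Lemma chebyshev2 d (T : measurableType d) (R : realType)
    (m : {measure set T -> \bar R}) (F : T -> R) (z : R) : (0 < z)%R ->
  measurable_fun setT F ->
  m [set w | (z <= `|F w|)%R] <= (z ^- 2)%:E * \int[m]_x (F x ^+ 2)%:E.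
Proof.
move=> z0 mF.
have mA : measurable [set w | (z <= `|F w|)%R] by exact: measurable_norm_ge.
have mF2 : measurable_fun setT (fun x => (F x ^+ 2)%:E).
  by apply/measurable_EFinP; exact: measurable_funX.
rewrite -ge0_integralZl//; last 2 first.
- by move=> x _; rewrite lee_fin sqr_ge0.
- by rewrite lee_fin invr_ge0 sqr_ge0.
have := integral_indic m measurableT mA; rewrite setIT => <-.
apply: ge0_le_integral => //.
- by apply/measurable_EFinP; exact: measurable_indic.
- exact: measurable_funeM.
- move=> x _; rewrite -EFinM lee_fin indicE.
  have [|_] := boolP (x \in _); last by rewrite mulr_ge0 ?invr_ge0 ?sqr_ge0.
  rewrite inE/= => zF; rewrite mulrC ler_pdivlMr ?exprn_gt0// mul1r.
  by rewrite -[leRHS]real_normK ?num_real// ler_pXn2r// nnegrE ltW.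
Qed.
End L2_tools.

Section wiener_integral_increment.
Context {d : measure_display} {Omega : measurableType d} {R : realType}.
Variable P : probability Omega R.
Local Notation mu := (@lebesgue_measure R).

Lemma step_fun_out (t x : R) (h : seq (R * (R * R))) :
  step_on t h -> t < x -> step_fun h x = 0.
Proof.
move=> /allP ht tx; rewrite /step_fun big_seq big1// => k /ht /and3P[_ _ k3].
by rewrite indicE memNset ?mulr0//= in_itv/= => /andP[_ xk]; lra.
Qed.

Lemma measurable_step_fun (h : seq (R * (R * R))) :
  measurable_fun setT (step_fun h).
Proof.
rewrite /step_fun; apply: measurable_sum => k.
by apply: measurable_funM => //; exact: measurable_indic.
Qed.

(* [6 * V] bounds the squared norm of the approximating step functions:
   [3 * (V + V / 2 + V / 2)], the last two terms being approximation errors. *)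
Lemma wiener_integral_increment_tail (W : R -> {RV P >-> R}) (T s t V z : R)
    (f g : R -> R) (Y Z : {RV P >-> R}) :
  wiener_process W -> 0 <= s -> s <= t -> t <= T ->
  wiener_integral W t f Y -> wiener_integral W s g Z ->
  (forall x, t <= x -> f x = 0) -> (forall x, s <= x -> g x = 0) ->
  0 < V -> 0 < z ->
  (\int[mu]_(x in `[0%R, T]) ((f x - g x) ^+ 2)%:E <= V%:E)%E ->
  (P [set w | (z <= `|Y w - Z w|)%R] <=
   (2 * expR (2^-1) * expR (- (z / 2 / Num.sqrt (6 * V))))%:E)%E.
Proof.
move=> hW s0 st tT [Lf [h [ht hf hY]]] [Lg [k [ks kg kZ]]] f0 g0 V0 z0 hV.
have T0 : 0 <= T by rewrite (le_trans s0)// (le_trans st).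
(* Concatenation with negated coefficients turns the two approximations into one step function
   approximating [f - g], whose integral obeys the exponential tail. *)
pose l n := h n ++ [seq (- j.1, j.2) | j <- k n].
have step_onW t' (j : seq (R * (R * R))) : t' <= T -> step_on t' j ->
  step_on T j.
  move=> t'T /allP H; apply/allP => i /H /and3P[-> -> i3] /=.
  exact: le_trans t'T.
have lT n : step_on T (l n).
  rewrite /step_on all_cat; apply/andP; split.
    exact: step_onW tT (ht n).
  by rewrite all_map; exact: step_onW (le_trans st tT) (ks n).
have lE n x : step_fun (l n) x = step_fun (h n) x - step_fun (k n) x.
  rewrite /step_fun big_cat/= big_map -sumrN; congr (_ + _).
  by apply: eq_bigr => i _; rewrite mulNr.
have lW n w : step_integral W (l n) w =
  step_integral W (h n) w - step_integral W (k n) w.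
  rewrite /step_integral big_cat/= big_map -sumrN; congr (_ + _).
  by apply: eq_bigr => i _; rewrite mulNr.
have patchI v (F : R -> R) : v <= T -> (forall x, v < x -> F x = 0) ->
    (\int[mu]_x ((F \_ `[0%R, v]) x ^+ 2)%:E =
      \int[mu]_(x in `[0%R, T]) (F x ^+ 2)%:E)%E.
  move=> vT F0; rewrite [RHS]integral_mkcond; apply: eq_integral => x _.
  rewrite !patchE; case: ifPn => [|xv].
    rewrite inE/= in_itv/= => /andP[x0 xv].
    by rewrite mem_set//= in_itv/= x0 (le_trans xv).
  rewrite expr0n/=; case: ifPn => //; rewrite inE/= in_itv/= => /andP[x0 xT].
  move: xv; rewrite notin_setE/= in_itv/= x0/= => /negP; rewrite -ltNge => vx.
  by rewrite F0// expr0n.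
have mrestr v (F : R -> R) : v <= T -> (forall x, v <= x -> F x = 0) ->
    Lp_on v 2%:E F -> measurable_fun `[0, T] F.
  move=> vT F0 LF; apply/(measurable_restrictT _ _).2 => //.
  rewrite (_ : F \_ `[0, T] = F \_ `[0, v]); first exact: Lp_on_measurable LF.
  apply/funext => x; rewrite !patchE; case: ifPn; case: ifPn => //.
    rewrite notin_setE inE/= !in_itv/= => + /andP[x0 xT]; rewrite x0/= => /negP.
    by rewrite -ltNge => /ltW; exact: F0.
  by rewrite notin_setE inE/= !in_itv/= => /andP[-> xv]; rewrite (le_trans xv).
have mf := mrestr _ _ tT f0 Lf.
have mg := mrestr _ _ (le_trans st tT) g0 Lg.
have Ef : \forall n \near \oo, (\int[mu]_(x in `[0%R, T])
    ((f x - step_fun (h n) x) ^+ 2)%:E <= (V / 2)%:E)%E.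
  have := Lnorm2_near_le hf (divr_gt0 V0 (ltr0n _ 2)); apply: filterS => n.
  rewrite patchI// => x tx; rewrite f0 ?(ltW tx)// (step_fun_out (ht n) tx).
  by rewrite subrr.
have Eg : \forall n \near \oo, (\int[mu]_(x in `[0%R, T])
    ((g x - step_fun (k n) x) ^+ 2)%:E <= (V / 2)%:E)%E.
  have := Lnorm2_near_le kg (divr_gt0 V0 (ltr0n _ 2)); apply: filterS => n.
  rewrite patchI ?(le_trans st)// => x tx;
    rewrite g0 ?(ltW tx)// (step_fun_out (ks n) tx).
  by rewrite subrr.
have msq (F : R -> R) : measurable_fun `[0, T] F ->
    measurable_fun `[0, T] (fun x : R => (F x ^+ 2)%:E).
  by move=> mF; apply/measurable_EFinP; exact: measurable_funX.
have mstep j : measurable_fun `[0, T] (step_fun j).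
  by apply: measurable_funTS; exact: measurable_step_fun.
(* The threshold [z] is split into [z / 2] for the step integral and [z / 4] for each approximation
   error. Chebyshev's inequality makes each error event of probability at most [e / 2], which
   dictates the [L^2] accuracy below. *)
apply/lee_addgt0Pr => e e0.
have e2 : 0 < e * (z / 4) ^+ 2 / 2 by rewrite divr_gt0// mulr_gt0// exprn_gt0//
  divr_gt0.
have EY := Lnorm2_near_le hY e2.
have EZ := Lnorm2_near_le kZ e2.
near \oo => n.
have Efn : (\int[mu]_(x in `[0%R, T]) ((f x - step_fun (h n) x) ^+ 2)%:E <=
  (V / 2)%:E)%E.
  by near: n.
have Egn : (\int[mu]_(x in `[0%R, T]) ((g x - step_fun (k n) x) ^+ 2)%:E <=
  (V / 2)%:E)%E.
  by near: n.
have EYn : (\int[P]_w ((Y w - step_integral W (h n) w) ^+ 2)%:E <=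
  (e * (z / 4) ^+ 2 / 2)%:E)%E.
  by near: n.
have EZn : (\int[P]_w ((Z w - step_integral W (k n) w) ^+ 2)%:E <=
  (e * (z / 4) ^+ 2 / 2)%:E)%E.
  by near: n.
have lV : (\int[mu]_(x in `[0%R, T]) (step_fun (l n) x ^+ 2)%:E <=
  (6 * V)%:E)%E.
  apply: (@le_trans _ _ (\int[mu]_(x in `[0%R, T])
    (3%:E * (((f x - g x) ^+ 2)%:E +
     ((f x - step_fun (h n) x) ^+ 2)%:E +
       ((g x - step_fun (k n) x) ^+ 2)%:E)))%E).
    apply: ge0_le_integral => //.
    - by move=> x _; rewrite lee_fin sqr_ge0.
    - exact: msq.
    - apply: measurable_funeM; apply: emeasurable_funD.
        by apply: emeasurable_funD; apply: msq; exact: measurable_funB.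
      by apply: msq; exact: measurable_funB.
    - move=> x _; rewrite -!EFinD -EFinM lee_fin lE.
      set a := f x; set b := g x; set a' := step_fun _ x; set b' :=
        step_fun _ x.
      have -> : a' - b' = (a - b) - (a - a') + (b - b') by ring.
      move: (a - b) (a - a') (b - b') => x1 x2 x3; rewrite -subr_ge0.
      have -> : 3 * (x1 ^+ 2 + x2 ^+ 2 + x3 ^+ 2) - (x1 - x2 + x3) ^+ 2 =
        (x1 + x2) ^+ 2 + (x1 - x3) ^+ 2 + (x2 + x3) ^+ 2 by ring.
      by rewrite !addr_ge0 ?sqr_ge0.
  have i1 (x : R) : `[0%R, T]%classic x -> (0 <= ((f x - g x) ^+ 2)%:E)%E.
    by rewrite lee_fin sqr_ge0.
  have i2 (x : R) : `[0%R, T]%classic x ->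
    (0 <= ((f x - step_fun (h n) x) ^+ 2)%:E)%E.
    by rewrite lee_fin sqr_ge0.
  have i3 (x : R) : `[0%R, T]%classic x ->
    (0 <= ((g x - step_fun (k n) x) ^+ 2)%:E)%E.
    by rewrite lee_fin sqr_ge0.
  have m1 : measurable_fun `[0, T] (fun x : R => ((f x - g x) ^+ 2)%:E).
    by apply: msq; exact: measurable_funB.
  have m2 : measurable_fun `[0, T] (fun x :
    R => ((f x - step_fun (h n) x) ^+ 2)%:E).
    by apply: msq; exact: measurable_funB.
  have m3 : measurable_fun `[0, T] (fun x :
    R => ((g x - step_fun (k n) x) ^+ 2)%:E).
    by apply: msq; exact: measurable_funB.
  have m12 := emeasurable_funD m1 m2.
  have i12 (x : R) : `[0%R, T]%classic x -> (0 <= ((f x - g x) ^+ 2)%:E +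
      ((f x - step_fun (h n) x) ^+ 2)%:E)%E.
    by move=> Tx; rewrite adde_ge0 ?i1 ?i2.
  rewrite ge0_integralZl//; last 2 first.
  - exact: emeasurable_funD.
  - by move=> x Tx; rewrite adde_ge0 ?i12 ?i3.
  rewrite ge0_integralD// ge0_integralD//.
  rewrite (_ : (6 * V)%:E = 3%:E * (V%:E + (V / 2)%:E + (V / 2)%:E))%E;
    last first.
    by rewrite -!EFinD -EFinM; congr (_%:E); field.
  by apply: lee_wpmul2l; rewrite ?lee_fin//; apply: leeD => //; exact: leeD.
have V6 : 0 < 6 * V by rewrite mulr_gt0.
have tail := step_integral_tail (z / 2) hW T0 (lT n) V6 lV.
have z4 : 0 < z / 4 by rewrite divr_gt0.
have mSh j : measurable_fun setT (step_integral W j) by exact: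
  step_integral_measurable.
have mYh : measurable_fun setT (fun w => Y w - step_integral W (h n) w).
  exact: measurable_funB.
have mZk : measurable_fun setT (fun w => Z w - step_integral W (k n) w).
  exact: measurable_funB.
have mYZ : measurable_fun setT (fun w => Y w - Z w) by exact: measurable_funB.
have cheb (F : Omega -> R) : measurable_fun setT F ->
    (\int[P]_w (F w ^+ 2)%:E <= (e * (z / 4) ^+ 2 / 2)%:E)%E ->
    (P [set w | (z / 4 <= `|F w|)%R] <= (e / 2)%:E)%E.
  move=> mF IF; apply: le_trans (chebyshev2 P z4 mF) _.
  apply: (@le_trans _ _ (((z / 4) ^- 2)%:E * (e * (z / 4) ^+ 2 / 2)%:E)%E).
    by apply: lee_wpmul2l => //; rewrite lee_fin invr_ge0 sqr_ge0.
  by rewrite -EFinM lee_fin le_eqVlt; apply/orP; left; apply/eqP; field;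
    rewrite gt_eqF.
have cY := cheb _ mYh EYn; have cZ := cheb _ mZk EZn.
apply: (@le_trans _ _ (P ([set w | (z / 2 <= `|step_integral W (l n) w|)%R] `|`
   ([set w | (z / 4 <= `|Y w - step_integral W (h n) w|)%R] `|`
    [set w | (z / 4 <= `|Z w - step_integral W (k n) w|)%R])))).
  apply: le_measure; rewrite ?inE; [exact: measurable_norm_ge| |].
    by apply: measurableU; [exact: measurable_norm_ge|apply: measurableU; exact:
      measurable_norm_ge].
  move=> w /=; rewrite lW => zYZ.
  have [?|h1] := leP (z / 2) `|step_integral W (h n) w - step_integral W (k n)
    w|; first by left.
  have [?|h2] := leP (z / 4) `|Y w - step_integral W (h n) w|; first by right;
    left.
  right; right; rewrite leNgt; apply/negP => h3.
  move: zYZ; apply/negP; rewrite -ltNge.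
  have -> : Y w - Z w = (Y w - step_integral W (h n) w) +
      (step_integral W (h n) w - step_integral W (k n) w) -
      (Z w - step_integral W (k n) w) by ring.
  apply: le_lt_trans (ler_normB _ _) _.
  apply: (@le_lt_trans _ _ (`|Y w - step_integral W (h n) w| +
      `|step_integral W (h n) w - step_integral W (k n) w| +
      `|Z w - step_integral W (k n) w|)); first by rewrite lerD2r ler_normD.
  by lra.
apply: (@le_trans _ _ (P [set w | (z / 2 <= `|step_integral W (l n) w|)%R] +
   P ([set w | (z / 4 <= `|Y w - step_integral W (h n) w|)%R] `|`
    [set w | (z / 4 <= `|Z w - step_integral W (k n) w|)%R]))%E).
  by apply: measureU2; [exact: measurable_norm_ge|apply: measurableU; exact:
    measurable_norm_ge].
apply: leeD; first exact: tail.
apply: (@le_trans _ _ (P [set w | (z / 4 <= `|Y w - step_integral W (h n) w|)%R]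
  +
    P [set w | (z / 4 <= `|Z w - step_integral W (k n) w|)%R])%E).
  by apply: measureU2; exact: measurable_norm_ge.
by rewrite [e in (_ <= e%:E)%E](_ : e = e / 2 + e / 2) ?EFinD ?leeD//; field.
Unshelve. all: by end_near.
Qed.
End wiener_integral_increment.

(** * Regularity of sample paths *)

Section dyadic_path.

Lemma eq_or_eqS (a b : nat) : (a < b.+2)%N -> (b < a.+1)%N -> a = b \/ a = b.+1.
Proof. lia. Qed.

Context {R : realType}.
Implicit Types (x : R -> R) (T s t g C : R).

Definition dyadic T (n k : nat) : R := T * k%:R / 2 ^+ n.

Definition dyadic_idx T (n : nat) t : nat := Num.truncn (2 ^+ n * t / T).

Definition dyadic_floor T (n : nat) t : R := dyadic T n (dyadic_idx T n t).

Lemma powRV_expr (x H : R) (n : nat) : 0 <= x ->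
  (x ^- n) `^ H = (x `^ H) ^- n.
Proof.
move=> x0; rewrite -powR_inv1 ?exprn_ge0// -powR_mulrn// -!powRrM.
rewrite -(powR_mulrn _ (powR_ge0 _ _)) -powRN -powRrM.
by congr (_ `^ _); ring.
Qed.

Lemma powR2_gt1 (x : R) : 0 < x -> 1 < 2 `^ x.
Proof.
move=> x0; have : 1 `^ x < 2 `^ x :> R.
  by apply: gt0_ltr_powR; rewrite ?nnegrE ?ltr1n.
by rewrite powR1.
Qed.

(** With [e n] the tail of the geometric series from [n] on, [u + e] decreases and [u - e] increases
    towards the same limit. This monotone squeeze yields convergence and rate together. *)
Lemma geometric_increments_cvg (u : nat -> R) (C q : R) : 0 <= q -> q < 1 ->
  (forall n, `|u n.+1 - u n| <= C * q ^+ n) ->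
  cvgn u /\ forall n, `|limn u - u n| <= C / (1 - q) * q ^+ n.
Proof.
move=> q0 q1 hu.
have q1' : 1 - q != 0 by rewrite gt_eqF// subr_gt0.
pose e n := C / (1 - q) * q ^+ n.
have eS n : e n - e n.+1 = C * q ^+ n.
  by rewrite /e exprS; field.
have C0 : 0 <= C by have := le_trans (normr_ge0 _) (hu 0%N);
  rewrite expr0 mulr1.
have e0 n : 0 <= e n by rewrite mulr_ge0 ?exprn_ge0// divr_ge0// subr_ge0 ltW.
have cve : e n @[n --> \oo] --> (0 : R).
  by apply: cvg_geometric; rewrite ger0_norm.
pose v n := u n + e n.
pose w n := u n - e n.
have v_dec : {homo v : n m / (n <= m)%N >-> m <= n}.
  apply/nonincreasing_seqP => n; have := hu n; rewrite ler_norml -eS /v; lra.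
have w_inc : {homo w : n m / (n <= m)%N >-> n <= m}.
  apply/nondecreasing_seqP => n; have := hu n; rewrite ler_norml -eS /w; lra.
have wv n : w n <= v n by rewrite /w /v; have := e0 n; lra.
have cv : cvgn v.
  apply: nonincreasing_is_cvgn => //; exists (w 0%N) => _ [n _ <-].
  exact: le_trans (w_inc _ _ (leq0n n)) (wv n).
have cvu : u n @[n --> \oo] --> limn v.
  have -> : u = (fun n => v n - e n) by apply/funext => n; rewrite /v addrK.
  by rewrite -[X in _ --> X]subr0; apply: cvgB.
have cvw : w n @[n --> \oo] --> limn v.
  by rewrite -[X in _ --> X]subr0; apply: cvgB.
have lu : limn u = limn v by apply: cvg_lim.
split; first by apply/cvg_ex; exists (limn v).
move=> n; rewrite lu ler_norml -/(e n); apply/andP; split.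
  have cw : cvgn w by apply/cvg_ex; exists (limn v).
  have := nondecreasing_cvgn_le w_inc cw n.
  by rewrite (cvg_lim _ cvw)// /w; lra.
by have := nonincreasing_cvgn_ge v_dec cv n; rewrite /v; lra.
Qed.

Lemma dyadic_idx_itv T n t : 0 < T -> 0 <= t ->
  (dyadic_idx T n t)%:R <= 2 ^+ n * t / T < (dyadic_idx T n t)%:R + 1.
Proof.
move=> T0 t0; rewrite natr1 truncn_itv//.
by rewrite divr_ge0 ?(ltW T0)// mulr_ge0.
Qed.

Lemma dyadic_idx_le T n t : 0 < T -> 0 <= t -> t <= T ->
  (dyadic_idx T n t <= 2 ^ n)%N.
Proof.
move=> T0 t0 tT; have /andP[h _] := dyadic_idx_itv n T0 t0.
rewrite -(ler_nat R) natrX (le_trans h)// ler_pdivrMr// ler_wpM2l// exprn_ge0.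
Qed.

Lemma dyadic_floor_itv T n t : 0 < T -> 0 <= t ->
  dyadic_floor T n t <= t < dyadic_floor T n t + T / 2 ^+ n.
Proof.
move=> T0 t0; have /andP[h1 h2] := dyadic_idx_itv n T0 t0.
have p0 : 0 < 2 ^+ n :> R by rewrite exprn_gt0.
rewrite /dyadic_floor /dyadic -mulrDl -[X in T * _ + X]mulr1 -mulrDr.
rewrite ler_pdivrMr// ltr_pdivlMr//.
rewrite ler_pdivlMr// in h1; rewrite ltr_pdivrMr// in h2.
by rewrite (mulrC T) (mulrC t) h1/= (mulrC T).
Qed.

Lemma dyadic_idxS T n t : 0 < T -> 0 <= t ->
  dyadic_idx T n.+1 t = (dyadic_idx T n t).*2 \/
  dyadic_idx T n.+1 t = (dyadic_idx T n t).*2.+1.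
Proof.
move=> T0 t0; have /andP[h1 h2] := dyadic_idx_itv n T0 t0.
have /andP[k1 k2] := dyadic_idx_itv n.+1 T0 t0.
move: k1 k2; rewrite exprS -!mulrA (mulrA (2 ^+ n)); set y := _ / T in h1 h2 *.
set a := dyadic_idx T n t in h1 h2 *; set b := dyadic_idx _ _ _ => k1 k2.
have lt1 : (b < a.*2.+2)%N by rewrite -(ltr_nat R) -muln2 -addn2 natrD natrM;
  lra.
have lt2 : (a.*2 < b.+1)%N by rewrite -(ltr_nat R) -[b.+1]addn1 natrD -muln2
  natrM; lra.
lia.
Qed.

Lemma dyadic_double T n k : dyadic T n.+1 k.*2 = dyadic T n k.
Proof.
rewrite /dyadic -muln2 natrM exprS; field.
by rewrite expf_neq0.
Qed.

(** Chaining: passing from level [n] to [n.+1] moves the dyadic floor by at most one step of the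
    finer grid, so the values converge geometrically. Two times are compared at the level whose mesh
    matches their distance, where their floors coincide or are neighbours. *)
Lemma dyadic_path_holder x T g C : 0 < T -> 0 < g -> 0 <= C ->
  (forall n k, (k < 2 ^ n)%N ->
    `|x (dyadic T n k.+1) - x (dyadic T n k)| <= C * (2 `^ (- g)) ^+ n) ->
  (forall t, t \in `[0, T] -> cvgn (fun n => x (dyadic_floor T n t))) /\
  holder_on `[0, T] g (fun t => limn (fun n => x (dyadic_floor T n t))).
Proof.
move=> T0 g0 C0 hx.
pose q : R := 2 `^ (- g).
have q0 : 0 < q by rewrite powR_gt0.
have q1 : q < 1.
  by rewrite /q powRN invf_lt1 ?powR_gt0// powR2_gt1.
pose F n t := x (dyadic_floor T n t).
have step t n : 0 <= t -> t <= T -> `|F n.+1 t - F n t| <= C * q ^+ n.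
  move=> t0 tT; rewrite /F /dyadic_floor.
  have := dyadic_idx_le n.+1 T0 t0 tT.
  have [->|->] := dyadic_idxS n T0 t0;
    rewrite -(dyadic_double T n (dyadic_idx T n t)).
    by rewrite subrr normr0 mulr_ge0// exprn_ge0// ltW.
  move=> /hx /le_trans; apply; rewrite ler_wpM2l// exprS ger_pMl ?exprn_gt0//.
  exact: ltW.
have lim t : 0 <= t -> t <= T -> cvgn (F ^~ t) /\
    forall n, `|limn (F ^~ t) - F n t| <= C / (1 - q) * q ^+ n.
  by move=> t0 tT; apply: geometric_increments_cvg;
    [exact: ltW| |move=> n; exact: step].
split; first by move=> t; rewrite in_itv/= => /andP[t0 tT]; exact:
  (lim t t0 tT).1.
(* One increment between neighbouring floors and two chaining tails, one for each time. *)
pose D := C + 2 * (C / (1 - q)).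
have D0 : 0 <= D by rewrite addr_ge0// mulr_ge0// divr_ge0// subr_ge0 ltW.
exists (D * (2 / T) `^ g).
have main s t : 0 <= s -> s < t -> t <= T ->
    `|limn (F ^~ t) - limn (F ^~ s)| <= D * (2 / T) `^ g * `|t - s| `^ g.
  move=> s0 st tT.
  have ts0 : 0 < t - s by rewrite subr_gt0.
  have t0 : 0 <= t by rewrite (le_trans s0)// ltW.
  have sT : s <= T by rewrite (le_trans (ltW st)).
  (* For the least such [n] the distance lies between [T / 2 ^+ n.+1] and [T / 2 ^+ n]; the lower
     bound yields the factor 2 in [(2 / T)], the upper one makes the floors neighbours. *)
  have ex : exists n, T / 2 ^+ n.+1 < t - s.
    have e0 : 0 < (t - s) / T by rewrite divr_gt0.
    have [N _ HN] := near_infty_natSinv_expn_lt (PosNum e0).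
    exists N; have := HN N.+1 (leqnSn N); rewrite /= div1r ltr_pdivlMr// mulrC.
    by [].
  have [n nP nmin] := ex_minnP ex.
  have tsn : t - s <= T / 2 ^+ n.
    case: n nP nmin => [|n] nP nmin; first by rewrite expr0 divr1; lra.
    by rewrite leNgt; apply/negP => /nmin; rewrite ltnn.
  have Fts : `|F n t - F n s| <= C * q ^+ n.
    have /andP[a1 a2] := dyadic_idx_itv n T0 t0.
    have /andP[b1 b2] := dyadic_idx_itv n T0 s0.
    have p0 : 0 < 2 ^+ n :> R by rewrite exprn_gt0.
    have y1 : 2 ^+ n * t / T <= 2 ^+ n * s / T + 1.
      rewrite -lerBlDl -mulrBl -mulrBr ler_pdivrMr// mul1r mulrC.
      by rewrite -ler_pdivlMr.
    have y2 : 2 ^+ n * s / T <= 2 ^+ n * t / T.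
      by rewrite ler_pM2r ?invr_gt0// ler_pM2l// ltW.
    have idx_le := dyadic_idx_le n T0 t0 tT.
    move: a1 a2 b1 b2 idx_le; rewrite /F /dyadic_floor.
    set a := dyadic_idx T n t; set b := dyadic_idx T n s => a1 a2 b1 b2 idx_le.
    have lt1 : (a < b.+2)%N by rewrite -(ltr_nat R) -addn2 natrD; lra.
    have lt2 : (b < a.+1)%N by rewrite -(ltr_nat R) -[a.+1]addn1 natrD; lra.
    have [->|ab] := eq_or_eqS lt1 lt2.
      by rewrite subrr normr0 mulr_ge0// exprn_ge0// ltW.
    by rewrite ab; apply: hx; rewrite -ab.
  have qn : q ^+ n <= (2 / T) `^ g * `|t - s| `^ g.
    rewrite -powRM ?divr_ge0 ?(ltW T0)// gtr0_norm//.
    rewrite /q powRN exprVn -powRV_expr//.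
    have r0 : 0 <= 2 / T * (t - s) by rewrite mulr_ge0 ?divr_ge0 ?(ltW T0)
      ?(ltW ts0).
    apply: ge0_ler_powR; rewrite ?nnegrE ?invr_ge0 ?exprn_ge0 ?(ltW g0)//.
    by rewrite mulrAC ler_pdivlMr//; move: nP; rewrite exprS invfM; lra.
  have [_ lt_] := lim t t0 tT; have [_ ls_] := lim s s0 sT.
  have lt1 := lt_ n; have ls1 := ls_ n.
  apply: (@le_trans _ _ (D * q ^+ n)); last by rewrite -mulrA ler_wpM2l.
  have -> : limn (F ^~ t) - limn (F ^~ s) = (limn (F ^~ t) - F n t) +
    (F n t - F n s) - (limn (F ^~ s) - F n s) by ring.
  apply: le_trans (ler_normB _ _) _.
  apply: (le_trans (lerD (ler_normD _ _) (lexx _))).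
  rewrite /D mulrDl -mulrA; lra.
move=> s t; rewrite /= !in_itv/= => /andP[s0 sT] /andP[t0 tT].
have [st|ts|->] := ltgtP s t.
- exact: main.
- by rewrite distrC (distrC t); exact: main.
- by rewrite !subrr normr0 powR0 ?mulr0// gt_eqF.
Qed.
End dyadic_path.

(** * Summability over dyadic levels *)

Section borel_cantelli.
Context {d : measure_display} {Omega : measurableType d} {R : realType}.
Variable P : probability Omega R.
Implicit Types (T H c rho : R).

(** The exponential dominates its Taylor term of degree [m.+1], with [m] so large that
    [rho ^+ m.+1 >= 4]; one factor [2 ^+ n] pays for the union bound and the other for summability.
    The weights [1 / 2 ^ n.+1] add up to 1. *)
Lemma expR_decay_pow2 (c rho : R) : 0 < c -> 1 < rho ->
  exists2 M : R, 0 <= M & forall n : nat,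
    2 ^+ n * expR (- (c * rho ^+ n)) <= M / (2 ^ n.+1)%:R.
Proof.
move=> c0 rho1.
have [m hm] : exists m, 4 <= rho ^+ m.+1.
  have r0 : 0 < rho by lra.
  have ir : `|rho^-1| < 1 by rewrite ger0_norm ?invr_ge0 ?(ltW r0)// invf_lt1.
  have q0 : (0 : R) < 4^-1 by rewrite invr_gt0.
  have /cvgrPdist_lt /(_ _ q0) [N _ HN] := cvg_expr ir.
  exists N; have := HN N.+1 (leqnSn N).
  rewrite /= sub0r normrN ger0_norm ?exprn_ge0 ?invr_ge0 ?(ltW r0)// exprVn.
  by rewrite ltf_pV2 ?posrE ?exprn_gt0// => /ltW.
pose f : R := (m.+1)`!%:R.
have f0 : 0 < f by rewrite ltr0n fact_gt0.
exists (2 * f / c ^+ m.+1); first by rewrite divr_ge0 ?mulr_ge0 ?exprn_ge0 ?ltW.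
move=> n; set y := c * rho ^+ n.
have rho0 : 0 < rho ^+ n by rewrite exprn_gt0//; lra.
have y0 : 0 < y by rewrite mulr_gt0.
have p0 : 0 < 2 ^+ n :> R by rewrite exprn_gt0.
have ey : y ^+ m.+1 / f <= expR y by have := expR_ge1Dxn m (ltW y0);
  rewrite -/f; lra.
have pow4 : 4 ^+ n <= (rho ^+ n) ^+ m.+1.
  rewrite -exprM mulnC exprM; apply: lerXn2r => //; rewrite nnegrE ?exprn_ge0//;
    lra.
have c1 : 0 < c ^+ m.+1 by rewrite exprn_gt0.
have key : 4 ^+ n <= f / c ^+ m.+1 * expR y.
  apply: (le_trans pow4); move: ey; rewrite ler_pdivrMr// exprMn => ey.
  by rewrite mulrAC ler_pdivlMr// mulrC (mulrC f).
rewrite natrX (exprS 2) expRN ler_pdivlMr ?mulr_gt0// mulrAC ler_pdivrMr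
  ?expR_gt0//.
have -> : 2 ^+ n * (2 * 2 ^+ n) = 2 * 4 ^+ n :> R.
  by rewrite mulrCA -expr2 -exprM mulnC exprM; congr (2 * _ ^+ n); ring.
by rewrite -!mulrA ler_pM2l// mulrA.
Qed.

Lemma borel_cantelli_pow2 (F : nat -> set Omega) (M : R) : 0 <= M ->
  (forall n, measurable (F n)) ->
  (forall n, P (F n) <= (M / (2 ^ n.+1)%:R)%:E)%E -> P (lim_sup_set F) = 0%E.
Proof.
move=> M0 mF hF; apply: lim_sup_set_cvg0 => //.
apply: (@le_lt_trans _ _ (M%:E)); last exact: ltry.
apply: (@le_trans _ _ (\sum_(0 <= n <oo) (0 + (M / (2 ^ n.+1)%:R)%:E))%E).
  apply: lee_nneseries => [n _ _|n _]; first exact: measure_ge0.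
  by rewrite add0e; exact: hF.
have := @epsilon_trick R (fun=> 0%E) M xpredT (fun=> lexx _) M0.
by move=> /le_trans; apply; rewrite eseries0// add0e.
Qed.

Lemma measurable_lim_sup_set (F : nat -> set Omega) :
  (forall n, measurable (F n)) -> measurable (lim_sup_set F).
Proof.
move=> mF; apply: bigcapT_measurable => n; exact: bigcup_measurable.
Qed.

Lemma notin_lim_sup_set (F : nat -> set Omega) w : ~ lim_sup_set F w ->
  exists N, forall n, (N <= n)%N -> ~ F n w.
Proof.
move=> /existsNP[N /not_implyP[_ hN]]; exists N => n Nn Fn.
by apply: hN; exists n.
Qed.
End borel_cantelli.

(** * Continuity criterion under exponential tails *)

Section kolmogorov_chentsov.
Context {d : measure_display} {Omega : measurableType d} {R : realType}.
Variable P : probability Omega R.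

(** A separate scale [dl > 0] covers [s = t], which occurs when a time is its own dyadic floor, and
    gives all increments of one dyadic level a common bound. *)
Definition exponential_increment_tails (T H : R) (X : R -> {RV P >-> R}) :
  Prop :=
  exists K D : R, [/\ 0 <= K, 0 < D & forall s t dl z, 0 <= s -> s <= t ->
    t <= T -> 0 < dl -> t - s <= dl -> 0 < z ->
    (P [set w | (z <= `|X t w - X s w|)%R] <=
     (K * expR (- (z / (D * dl `^ H))))%:E)%E].

Lemma measurable_increment_event (X : R -> {RV P >-> R}) (s t z : R) :
  measurable [set w | (z <= `|X t w - X s w|)%R].
Proof. by apply: measurable_norm_ge; exact: measurable_funB. Qed.

(** At level [n] the ratio of the threshold [2^(-ng)] to the scale [(T / 2^n)^H] grows like
    [2^(n(H-g))]. The factor [2 ^+ n] on the left counts the increments in the union bound. *)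
Lemma dyadic_increment_tail (T H g : R) (X : R -> {RV P >-> R}) : 0 < T ->
  g < H -> exponential_increment_tails T H X ->
  exists2 M : R, 0 <= M & forall n s t, 0 <= s -> s <= t -> t <= T ->
    t - s <= T / 2 ^+ n ->
    ((2 ^+ n)%:E * P [set w | ((2 `^ (- g)) ^+ n <= `|X t w - X s w|)%R] <=
     (M / (2 ^ n.+1)%:R)%:E)%E.
Proof.
move=> T0 gH [K [D [K0 D0 tail]]].
pose c := (D * T `^ H)^-1; pose rho : R := 2 `^ (H - g).
have c0 : 0 < c by rewrite invr_gt0 mulr_gt0// powR_gt0.
have rho1 : 1 < rho by rewrite powR2_gt1// subr_gt0.
have [M M0 HM] := expR_decay_pow2 c0 rho1.
exists (K * M); first exact: mulr_ge0.
move=> n s t s0 st tT ts.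
have p0 : 0 < 2 ^+ n :> R by rewrite exprn_gt0.
have := tail s t (T / 2 ^+ n) ((2 `^ (- g)) ^+ n) s0 st tT (divr_gt0 T0 p0) ts.
rewrite exprn_gt0 ?powR_gt0// => /(_ isT) le1.
apply: (@le_trans _ _ ((2 ^+ n)%:E * (K * expR (- (c * rho ^+ n)))%:E)%E);
  last first.
  by rewrite -EFinM lee_fin mulrCA -mulrA ler_wpM2l.
apply: lee_wpmul2l; first by rewrite lee_fin ltW.
rewrite (_ : c * rho ^+ n = 2 `^ (- g) ^+ n / (D * (T / 2 ^+ n) `^ H))//.
have pH : 0 < T `^ H by rewrite powR_gt0.
have qH : 0 < (2 `^ H) ^+ n by rewrite exprn_gt0// powR_gt0.
have -> : (T / 2 ^+ n) `^ H = T `^ H / (2 `^ H) ^+ n.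
  by rewrite powRM ?(ltW T0) ?invr_ge0 ?(ltW p0)// powRV_expr.
rewrite /c /rho powRD ?pnatr_eq0 ?implybT// exprMn.
move: (T `^ H) ((2 `^ H) ^+ n) ((2 `^ (- g)) ^+ n) pH qH => x y z x0 y0.
by field; rewrite !gt_eqF.
Qed.

Lemma kolmogorov_chentsov (T H0 : R) (X : R -> {RV P >-> R}) : 0 < T -> 0 <
  H0 ->
  (forall H, 0 < H -> H < H0 -> exponential_increment_tails T H X) ->
  exists Y : R -> {RV P >-> R}, modification_on `[0, T] X Y /\
    forall w, holder_up_to `[0, T] H0%:E (fun t => Y t w).
Proof.
move=> T0 H00 tails.
(* Increasing to [H0]: countably many exponents suffice. *)
pose gam (j : nat) : R := H0 * (1 - (j.+2)%:R^-1).
have gam0 j : 0 < gam j.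
  by rewrite mulr_gt0// subr_gt0 invf_lt1// ltr1n.
have gamH j : gam j < H0 by rewrite gtr_pMr// gtrBl invr_gt0.
have dec j : exists2 M : R, 0 <= M & forall n s t, 0 <= s -> s <= t -> t <= T ->
    t - s <= T / 2 ^+ n ->
    ((2 ^+ n)%:E * P [set w | ((2 `^ (- gam j)) ^+ n <= `|X t w - X s w|)%R] <=
     (M / (2 ^ n.+1)%:R)%:E)%E.
  have mid1 : gam j < (gam j + H0) / 2 by have := gamH j; lra.
  have mid2 : (gam j + H0) / 2 < H0 by have := gamH j; lra.
  apply: (@dyadic_increment_tail T ((gam j + H0) / 2) (gam j) X T0 mid1).
  by apply: tails => //; exact: lt_trans (gam0 j) mid1.
pose q j : R := 2 `^ (- gam j).
have q0 j : 0 < q j by rewrite powR_gt0.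
pose A j n (k : nat) := [set w | (q j ^+ n <=
  `|X (dyadic T n k.+1) w - X (dyadic T n k) w|)%R].
pose E j n := \big[setU/set0]_(k < 2 ^ n) A j n k.
have mA j n k : measurable (A j n k) by exact: measurable_increment_event.
have mE j n : measurable (E j n) by apply: bigsetU_measurable => k _; exact: mA.
have PE j : P (lim_sup_set (E j)) = 0%E.
  have [M M0 HM] := dec j; apply: (@borel_cantelli_pow2 _ _ _ P _ M M0) => // n.
  have p0 : 0 < 2 ^+ n :> R by rewrite exprn_gt0.
  apply: le_trans (Boole_inequality P (fun k _ => mA j n k)) _.
  have dk (k : 'I_(2 ^ n)) : [/\ 0 <= dyadic T n k, dyadic T n k <=
    dyadic T n k.+1,
      dyadic T n k.+1 <= T & dyadic T n k.+1 - dyadic T n k <= T / 2 ^+ n].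
    split; rewrite /dyadic.
    - by rewrite divr_ge0 ?(ltW p0)// mulr_ge0// ltW.
    - by rewrite ler_pM2r ?invr_gt0// ler_pM2l// ler_nat.
    - by rewrite ler_pdivrMr// ler_pM2l// -natrX ler_nat.
    - by rewrite -mulrBl -mulrBr -natrB// subSnn mulr1.
  apply: (@le_trans _ _ (\sum_(k < 2 ^ n) (M / (2 ^ n.+1)%:R / 2 ^+ n)%:E)%E).
    apply: lee_sum => k _; have [d1 d2 d3 d4] := dk k.
    rewrite EFinM lee_pdivlMr// muleC; exact: HM d1 d2 d3 d4.
  rewrite sumEFin lee_fin sumr_const card_ord -[leLHS]mulr_natl (natrX _ 2 n)
    (mulrC (2 ^+ n)) divfK// gt_eqF.
pose G : set Omega := ~` \bigcup_j lim_sup_set (E j).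
have mL j : measurable (lim_sup_set (E j)) by exact: measurable_lim_sup_set.
have mG : measurable G by apply: measurableC; exact: bigcup_measurable.
have negG : P.-negligible (~` G).
  rewrite setCK; apply: negligible_bigcup => j.
  by apply/negligibleP; [exact: mL|exact: PE].
have path w j : G w -> exists2 C : R, 0 <= C & forall n k, (k < 2 ^ n)%N ->
    `|X (dyadic T n k.+1) w - X (dyadic T n k) w| <= C * q j ^+ n.
  move=> Gw; have [|N HN] := @notin_lim_sup_set _ _ (E j) w.
    by move=> Ew; apply: Gw; exists j.
  pose D n k := `|X (dyadic T n k.+1) w - X (dyadic T n k) w|.
  (* From level [N] on the constant 1 suffices; the finitely many increments of the lower levels are
     covered by adding all their ratios. *)
  pose C := 1 + \sum_(n < N) \sum_(k < 2 ^ n) D n k / q j ^+ n.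
  have qn n : 0 < q j ^+ n by rewrite exprn_gt0.
  have D0 n k : 0 <= D n k / q j ^+ n by apply: divr_ge0;
    [exact: normr_ge0|exact: ltW].
  have S0 n : 0 <= \sum_(k < 2 ^ n) D n k / q j ^+ n by apply: sumr_ge0.
  have C1 : 1 <= C by rewrite lerDl; apply: sumr_ge0.
  exists C; first by rewrite (le_trans _ C1).
  move=> n k kn; have [Nn|nN] := leqP N n.
    apply: (@le_trans _ _ (q j ^+ n)); last by rewrite ler_peMl// ltW.
    rewrite leNgt; apply/negP => h; apply: (HN n Nn).
    by rewrite /E -(bigcup_mkord (2 ^ n) (A j n)); exists k => //=; exact: ltW.
  rewrite -ler_pdivrMr// -/(D n k); apply: ler_wpDl => //.
  rewrite (bigD1 (Ordinal nN))//=; apply: ler_wpDr; first by apply: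
    sumr_ge0 => i _; exact: S0.
  by rewrite (bigD1 (Ordinal kn))//=; apply: ler_wpDr => //; apply:
    sumr_ge0 => i _; exact: D0.
(* Cutting off outside [G] before the limit makes the sequence converge for every [w], so the limit
   is measurable; the paths outside [G] are zero, which gives the Hölder condition surely. *)
pose Xn n t w := \1_G w * X (dyadic_floor T n t) w.
pose Yf t w := if t \in `[0, T] then limn (fun n => Xn n t w) else 0.
have cvgX w t : G w -> t \in `[0, T] ->
  cvgn (fun n => X (dyadic_floor T n t) w).
  move=> Gw tT; have [C C0 HC] := path w 0%N Gw.
  have [cv _] := @dyadic_path_holder R (fun t => X t w) T (gam 0%N) C T0
    (gam0 _) C0 HC.
  exact: cv.
have XnG w t : G w -> (fun n => Xn n t w) = (fun n => X (dyadic_floor T n t) w).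
  by move=> Gw; apply/funext => n; rewrite /Xn indicE mem_set// mul1r.
have XnNG w t : ~ G w -> (fun n => Xn n t w) = (fun n => 0).
  by move=> Gw; apply/funext => n; rewrite /Xn indicE memNset// mul0r.
have cvgXn w t : t \in `[0, T] -> cvgn (fun n => Xn n t w).
  move=> tT; have [Gw|Gw] := pselect (G w); first by rewrite XnG//; exact: cvgX.
  by rewrite XnNG//; exact: is_cvg_cst.
have mY t : measurable_fun setT (Yf t).
  rewrite /Yf; have [tT|tT] := boolP (t \in _); last exact: measurable_cst.
  apply: (@measurable_fun_cvg _ _ _ _ (fun n => Xn n t)).
    by move=> n; apply: measurable_funM => //; exact: measurable_indic.
  by move=> w _; exact: cvgXn.
have /choice[Y HY] : forall t, exists Z : {RV P >-> R}, forall w, Z w = Yf t w.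
  by move=> t; exists (mfun_Sub (mem_set (mY t))) => w; rewrite mfun_valP.
exists Y; split.
  move=> t tT.
  have := tT; rewrite /= in_itv/= => /andP[t0 tT'].
  have fl n := dyadic_floor_itv n T0 t0.
  have fl0 n : 0 <= dyadic_floor T n t.
    by rewrite /dyadic_floor /dyadic divr_ge0 ?exprn_ge0// mulr_ge0// ltW.
  have flt n : dyadic_floor T n t <= t by have /andP[] := fl n.
  have fld n : t - dyadic_floor T n t <= T / 2 ^+ n.
    by have /andP[_] := fl n; lra.
  have [M M0 HM] := dec 0%N.
  (* A second Borel-Cantelli argument, at fixed [t]: the values at the dyadic floors also converge
     to [X t] almost surely, which identifies the limit. Any exponent would do, so index 0 is
     taken. *)
  pose F n := [set w | (q 0%N ^+ n <= `|X t w - X (dyadic_floor T n t) w|)%R].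
  have mF n : measurable (F n) by exact: measurable_increment_event.
  have PF : P (lim_sup_set F) = 0%E.
    apply: (@borel_cantelli_pow2 _ _ _ P _ M M0) => // n.
    apply: le_trans (HM n _ _ (fl0 n) (flt n) tT' (fld n)).
    rewrite -[leLHS]mul1e; apply: lee_wpmul2r => //.
    by rewrite lee_fin exprn_ege1// ler1n.
  have negF : P.-negligible (lim_sup_set F).
    by apply/negligibleP => //; exact: measurable_lim_sup_set.
  apply: negligibleS (negligibleU negG negF) => w /= YX.
  have [Gw|] := pselect (G w); last by left.
  right; apply: contrapT => /notin_lim_sup_set[N HN]; apply: YX.
  rewrite HY /Yf tT XnG//; apply/cvg_lim => //.
  apply/cvgrPdist_le => e e0.
  have q1 : `|q 0%N| < 1.
    by rewrite ger0_norm ?(ltW (q0 _))// /q powRN invf_lt1 ?powR_gt0//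
      powR2_gt1.
  have /cvgrPdist_le /(_ _ e0) [N' _ HN'] := cvg_expr q1.
  exists (maxn N N') => // n /=; rewrite geq_max => /andP[nN nN'].
  have := HN n nN; rewrite /F/= => /negP; rewrite -ltNge => /ltW /le_trans;
    apply.
  have := HN' n nN'; rewrite /= sub0r normrN; apply: le_trans; exact: ler_norm.
move=> w g g0; rewrite lte_fin => gH.
have [Gw|Gw] := pselect (G w); last first.
  exists 0 => s t sT tT; rewrite !HY /Yf sT tT !XnNG// !lim_cst// subrr normr0
    mul0r.
  by [].
have [j gj] : exists j, g <= gam j.
  have e0 : 0 < (H0 - g) / H0 by rewrite divr_gt0// subr_gt0.
  have [N _ HN] := near_infty_natSinv_lt (PosNum e0).
  exists N; have := HN N.+1 (leqnSn N); rewrite /= ltr_pdivlMr// /gam => h.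
  by rewrite mulrBr mulr1 lerBrDr -lerBrDl mulrC ltW.
have [C C0 HC] := path w j Gw.
have [_ [L HL]] := @dyadic_path_holder R (fun t => X t w) T (gam j) C T0
  (gam0 _) C0 HC.
(* On an interval of length [T], passing from the exponent [gam j] to the smaller [g] costs the
   factor [T^(gam j - g)]. *)
exists (`|L| * T `^ (gam j - g)) => s t sT tT.
rewrite !HY /Yf sT tT !XnG//.
apply: le_trans (HL _ _ sT tT) _.
have [->|st] := eqVneq s t.
  by rewrite subrr normr0 !powR0 ?mulr0// gt_eqF.
have ts0 : 0 < `|t - s| by rewrite normr_gt0 subr_eq0 eq_sym.
have -> : `|t - s| `^ gam j = `|t - s| `^ (gam j - g) * `|t - s| `^ g.
  by rewrite -powRD ?subrK ?(gt_eqF ts0) ?implybT.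
rewrite mulrA ler_wpM2r ?powR_ge0//.
apply: (@le_trans _ _ (`|L| * `|t - s| `^ (gam j - g))).
  by rewrite ler_wpM2r ?powR_ge0// ler_norm.
rewrite ler_wpM2l//; apply: ge0_ler_powR;
  rewrite ?nnegrE ?subr_ge0// ?(ltW T0)//.
move: sT tT; rewrite /= !in_itv/= => /andP[s0 sT] /andP[t0 tT].
by rewrite ler_norml; lra.
Qed.
End kolmogorov_chentsov.

(** * Conclusion *)

Lemma volterra_increment_tails (R : realType) (d : measure_display)
    (Omega : measurableType d) (P : probability Omega R)
    (W : R -> {RV P >-> R}) (T : R) (p q r : \bar R) (a b c : R -> R)
    (ip iq ir H : R) (X : R -> {RV P >-> R}) :
  wiener_process W -> 0 < T -> (1 <= p)%E -> (1 <= q)%E -> (1 <= r)%E ->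
  p^-1%E = ip%:E -> q^-1%E = iq%:E -> r^-1%E = ir%:E ->
  Lp_on T p a -> Lp_on T q b -> Lp_on T r c ->
  ip <= 2^-1 -> 0 < H -> H < 3 / 2 - iq - Num.max (2^-1) (ip + ir) ->
  (forall t, t \in `[0, T] -> wiener_integral W t (volterra_kernel a b c t)
    (X t)) ->
  exponential_increment_tails T H X.
Proof.
move=> hW T0 p1 q1 r1 pE qE rE La Lb Lc ip2 H0 HH hX.
have [K K0 HK] := volterra_kernel_increment_L2 T0 p1 q1 r1 pE qE rE La Lb Lc ip2
  H0 HH.
have sq0 : 0 < Num.sqrt (6 * (K + 1)) by rewrite sqrtr_gt0 mulr_gt0//; lra.
(* The second constant collects the halved threshold and the bound [6 * V]. [K + 1] replaces [K],
   which may be zero, because the tail estimate needs a positive [V]. *)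
exists (2 * expR 2^-1), (2 * Num.sqrt (6 * (K + 1))); split.
- by rewrite mulr_ge0 ?expR_ge0.
- by rewrite mulr_gt0.
move=> s t dl z s0 st tT dl0 tsdl z0.
have pdl : 0 < dl `^ (2 * H) by rewrite powR_gt0.
have V0 : 0 < (K + 1) * dl `^ (2 * H) by rewrite mulr_gt0//; lra.
have sT : s \in `[0, T] by rewrite in_itv/= s0 (le_trans st).
have tT' : t \in `[0, T] by rewrite in_itv/= tT (le_trans s0).
have intV := HK s t dl s0 st tT dl0 tsdl.
have := wiener_integral_increment_tail hW s0 st tT (hX t tT') (hX s sT)
  (@volterra_kernel_support _ a b c t) (@volterra_kernel_support _ a b c s) V0
    z0.
rewrite (_ : z / 2 / Num.sqrt (6 * ((K + 1) * dl `^ (2 * H))) =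
  z / (2 * Num.sqrt (6 * (K + 1)) * dl `^ H)).
  by apply; apply: le_trans intV _; rewrite lee_fin ler_wpM2r ?(ltW pdl)//; lra.
rewrite mulrA sqrtrM; last by rewrite mulr_ge0//; lra.
rewrite mulrC (mulrC 2) powRrM powR_mulrn ?powR_ge0// sqrtr_sqr ger0_norm
  ?powR_ge0//.
have p0 : 0 < dl `^ H by rewrite powR_gt0.
by field; rewrite !gt_eqF.
Qed.

Theorem theorem2 (R : realType) (d : measure_display)
    (Omega : measurableType d) (P : probability Omega R)
    (W : R -> {RV P >-> R}) (hW : wiener_process W)
    (T : R) (hT : 0 < T) (p q r : \bar R)
    (hp : (2%:E <= p)%E) (hq : (1 < q)%E) (hr : (1 <= r)%E)
    (hpqr : (p^-1 + q^-1 + r^-1 < (3 / 2)%:E)%E)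
    (a b c : R -> R) (ha : Lp_on T p a) (hb : Lp_on T q b) (hc : Lp_on T r c) :
  [/\ {ae (@lebesgue_measure R), forall s, s \in `[0, T] ->
        (@lebesgue_measure R).-integrable `[s, T]
          (fun u => (b u * c (u - s))%:E)},
      forall t, t \in `[0, T] -> Lp_on t 2%:E (volterra_kernel a b c t)
    & forall X : R -> {RV P >-> R},
        (forall t, t \in `[0, T] -> wiener_integral W t (volterra_kernel a b c t) (X t)) ->
        exists Y : R -> {RV P >-> R},
          modification_on `[0, T] X Y /\
          forall w, holder_up_to `[0, T]
            ((3 / 2)%:E - q^-1 - maxe (2^-1)%:E (p^-1 + r^-1))%E
            (fun t => Y t w)].
Proof.
have p1 : (1 <= p)%E by rewrite (le_trans _ hp)// lee_fin ler1n.
split.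
- exact: volterra_integrand_ae_integrable (ltW hq) hr hb hc.
- by move=> t; exact: volterra_kernel_Lp hT hp hq hr hpqr ha hb hc.
move=> X hX.
have [ip [iq [ir [[pE qE rE] ip2 H0 ->]]]] := holder_exponentsE hp hq hr hpqr.
apply: kolmogorov_chentsov => // H Hgt0 HH.
exact: volterra_increment_tails hW hT p1 (ltW hq) hr pE qE rE ha hb hc ip2 Hgt0
  HH hX.
Qed.
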